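(* Let $n\ge 1$, let $P\in Hyp_n$ and $Q\in Hyp_n^-$, and let $u,v,w\ge 0$ with $u+v+w=n$ be such that $P\in H_{u,v,w}$. Then the following hold. (o) $P\ast Q\in H_{u,v,w}$; and whenever $\alpha\ne 0$ is a root of $P$ of multiplicity $m_\alpha$ and $\beta$ is a root of $Q$ of multiplicity $m_\beta$ with $m_\alpha+m_\beta>n$, the number $-\alpha\beta$ is a root of $P\ast Q$ of multiplicity exactly $m_\alpha+m_\beta-n$. (i) For any A-root $\alpha\neq 0$ of $P$ and any A-root $\beta$ of $Q$ one has $$[-\alpha\beta]_-=[\alpha]_-+[\beta]_{\mathrm{sign}(\alpha)},$$ where $[-\alpha\beta]_-$ is computed with respect to $P\ast Q$, $[\alpha]_-$ with respect to $P$, and $[\beta]_{\mathrm{sign}(\alpha)}$ with respect to $Q$ (so it is $[\beta]_+$ if $\alpha>0$ and $[\beta]_-$ if $\alpha<0$). (ii) Every B-root of $P\ast Q$ is simple. Moreover, the multiplicity vector $MV_{P\ast Q}$ is uniquely determined by these conditions; that is, $MV_{P\ast Q}$ depends only on $MV_P$, $MV_Q$ and $(u,v,w)$, and is the unique ordered partition of $n$ compatible with (o), (i) and (ii).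
   Context: Fix $n\ge 1$. The Schur–Szegő composition (with respect to $n$) of $P(x)=\sum_{i=0}^n\binom{n}{i}a_ix^i$ and $Q(x)=\sum_{i=0}^n\binom{n}{i}b_ix^i$ is $P\ast Q(x)=\sum_{i=0}^n\binom{n}{i}a_ib_ix^i$. $Hyp_n$ is the set of real polynomials of degree $n$ all of whose roots are real. $Hyp_n^-\subset Hyp_n$ is the subset of polynomials all of whose roots are negative. For integers $u,v,w\ge 0$ with $u+v+w=n$, $H_{u,v,w}\subset Hyp_n$ is the set of polynomials having (counted with multiplicity) $u$ negative roots, $w$ positive roots, and $0$ as a root of multiplicity $v$. For $P\in Hyp_n$, the multiplicity vector $MV_P$ is the ordered partition (composition) of $n$ formed by the multiplicities of the distinct roots of $P$ listed in increasing order of the roots. For a root $\alpha$ of $P\in Hyp_n$, $[\alpha]_-$ (resp. $[\alpha]_+$) denotes the total number of roots of $P$, counted with multiplicity, lying strictly to the left (resp. strictly to the right) of $\alpha$; $\mathrm{sign}(\alpha)\in\{+,-\}$ is the sign of $\alpha\neq 0$. A-roots and B-roots (defined relative to the pair $P,Q$): whenever $x_P$ is a root of $P$ of multiplicity $m_P$ and $x_Q$ is a root of $Q$ of multiplicity $m_Q$ with $m_P+m_Q>n$, the roots $x_P$ of $P$, $x_Q$ of $Q$, and $-x_Px_Q$ of $P\ast Q$ are called A-roots (of $P$, $Q$, $P\ast Q$ respectively). In addition, if $0$ is a root of $P$, then $0$ is considered an A-root of $P\ast Q$. All remaining roots of $P$, $Q$, $P\ast Q$ are called B-roots. *)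

(* Defs.v *)
From mathcomp Require Import all_boot all_order all_algebra.
From mathcomp Require Import reals.
From mathcomp.real_closed Require Import polyrcf complex.

Set Implicit Arguments.
Unset Strict Implicit.
Unset Printing Implicit Defensive.

Import Order.TTheory GRing.Theory Num.Theory.

Local Open Scope ring_scope.

(* [p`_i / 'C(n, i)%:R] is the coefficient a_i of p = \sum_i 'C(n, i) a_i x^i. *)
Definition schur_szego (R : realType) (n : nat) (p q : {poly R}) : {poly R} :=
  \poly_(i < n.+1)
     ('C(n, i)%:R * (p`_i / 'C(n, i)%:R) * (q`_i / 'C(n, i)%:R)).

(* "All roots are real" refers to the complex roots. *)
Definition Hyp (R : realType) (n : nat) (p : {poly R}) : Prop :=
  size p = n.+1 /\
  forall z : R[i], root (map_poly (real_complex R) p) z ->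
    exists x : R, z = real_complex R x.

Definition Hyp_neg (R : realType) (n : nat) (p : {poly R}) : Prop :=
  Hyp n p /\ forall x : R, root p x -> x < 0.

(* [rootsR p] lists the distinct real roots of p != 0 in increasing order and
   [mup x p] is the multiplicity of x as a root of p (0 if it is not a root). *)
Definition MV (R : realType) (p : {poly R}) : seq nat :=
  [seq mup x p | x <- rootsR p].

Definition nb_left (R : realType) (p : {poly R}) (a : R) : nat :=
  (\sum_(x <- rootsR p | (x < a)%R) mup x p)%N.

Definition nb_right (R : realType) (p : {poly R}) (a : R) : nat :=
  (\sum_(x <- rootsR p | (a < x)%R) mup x p)%N.

Definition nb_sign (R : realType) (a : R) (q : {poly R}) (b : R) : nat :=
  if 0 < a then nb_right q b else nb_left q b.

Definition Huvw (R : realType) (n u v w : nat) (p : {poly R}) : Prop :=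
  [/\ Hyp n p, nb_left p 0 = u, mup 0 p = v & nb_right p 0 = w].

Definition A_pair (R : realType) (n : nat) (P Q : {poly R}) (x y : R) : Prop :=
  [/\ root P x, root Q y & (n < mup x P + mup y Q)%N].

Definition A_root_l (R : realType) (n : nat) (P Q : {poly R}) (x : R) : Prop :=
  exists y : R, A_pair n P Q x y.

Definition A_root_r (R : realType) (n : nat) (P Q : {poly R}) (y : R) : Prop :=
  exists x : R, A_pair n P Q x y.

(* The numbers which are declared to be A-roots of the composition. *)
Definition A_root_comp (R : realType) (n : nat) (P Q : {poly R}) (z : R) : Prop :=
  (exists x y : R, A_pair n P Q x y /\ z = - (x * y)) \/ (root P 0 /\ z = 0).

(* The three conditions relative to the pair (P, Q) are stated for an arbitrary
   polynomial S in the role of the composition, so that one can express that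
   they determine its multiplicity vector. *)
Definition cond_o (R : realType) (n u v w : nat) (P Q S : {poly R}) : Prop :=
  Huvw n u v w S /\
  forall a b : R, a != 0 -> root P a -> root Q b ->
    (n < mup a P + mup b Q)%N ->
    root S (- (a * b)) /\ mup (- (a * b)) S = (mup a P + mup b Q - n)%N.

Definition cond_i (R : realType) (n : nat) (P Q S : {poly R}) : Prop :=
  forall a b : R, a != 0 -> A_root_l n P Q a -> A_root_r n P Q b ->
    nb_left S (- (a * b)) = (nb_left P a + nb_sign a Q b)%N.

Definition cond_ii (R : realType) (n : nat) (P Q S : {poly R}) : Prop :=
  forall z : R, root S z -> ~ A_root_comp n P Q z -> mup z S = 1%N.

Definition ordered_partition (n : nat) (c : seq nat) : Prop :=
  sumn c = n /\ 0%N \notin c.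

(* If c is the multiplicity vector of p, these are [.]_- and [.]_+ of the k-th
   root of p, for k counted from 0. *)
Definition before (c : seq nat) (k : nat) : nat := sumn (take k c).
Definition after (c : seq nat) (k : nat) : nat := sumn (drop k.+1 c).

(* For P in H_{u,v,w} with MV_P = mP and Q with MV_Q = mQ: the i-th root of P is
   nonzero (it is negative iff [before mP i < u], and zero iff
   [u <= before mP i < u + v]), and its multiplicity and that of the j-th root
   of Q add up to more than n. *)
Definition A_index (n u v : nat) (mP mQ : seq nat) (i j : nat) : Prop :=
  [/\ (i < size mP)%N, (j < size mQ)%N,
      ~~ (u <= before mP i < u + v)%N & (n < nth 0%N mP i + nth 0%N mQ j)%N].

(* The value that condition (i) prescribes for [-ab]_-, where a is the i-th root
   of P and b the j-th root of Q. *)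
Definition A_position (u : nat) (mP mQ : seq nat) (i j : nat) : nat :=
  (before mP i + (if before mP i < u then before mQ j else after mQ j))%N.

(* The conditions (o), (i), (ii) read on an ordered partition c.  A part of c is
   identified by the sum of the parts preceding it.  The first clause is
   membership in H_{u,v,w}: when v > 0 the part of the root 0 separates those of
   the negative and of the positive roots.  The second clause joins the
   multiplicities of (o) with the positions of (i): an A-root a of P and an
   A-root b of Q always satisfy m_a + m_b > n, because otherwise a and b, and
   A-roots paired with them, would account for more than 2n roots of P and Q. *)
Definition compatible (n u v w : nat) (mP mQ c : seq nat) : Prop :=
  [/\ exists cneg cpos : seq nat,
        [/\ c = cneg ++ nseq (0 < v)%N v ++ cpos, sumn cneg = u
          & sumn cpos = w],
      forall i j : nat, A_index n u v mP mQ i j ->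
        exists k : nat,
          [/\ (k < size c)%N, before c k = A_position u mP mQ i j
            & nth 0%N c k = (nth 0%N mP i + nth 0%N mQ j - n)%N]
    & forall k : nat, (k < size c)%N ->
        ~ (exists i j : nat, A_index n u v mP mQ i j /\
                             before c k = A_position u mP mQ i j) ->
        ~ ((0 < v)%N /\ before c k = u) ->
        nth 0%N c k = 1%N].

(* Main.v *)
Require Import Defs.
From mathcomp Require Import all_boot all_order all_algebra.
From mathcomp Require Import reals ring lra zify.
From mathcomp.real_closed Require Import polyrcf complex.

(* Write Q, up to a constant, as the product of the factors 1 + t X with t > 0
   (t = -1/y for the roots y of Q), and put D_xi P = n P + (xi - X) P', the polar
   derivative of P with respect to xi.  Then n (P*Q)(x) is the value at x of the
   composition, with respect to n - 1, of D_{t x} P and Q / (1 + t X).  Hence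
   (P*Q)(x) is obtained from P by successive polar derivatives with respect to
   the real numbers t x, which commute and preserve real-rootedness.
   (1) Let G be the composition of P' and Q / (1 + t X).  Then f = P*Q satisfies
   f' G - f G' >= (t/n) G^2, because f' G - f G' is the sum of t G^2 / n and of
   positive multiples of discriminants of real-rooted quadratic polynomials,
   which are polar derivatives of P.
   (2) At a multiple root x of f, (1) gives G(x) = 0, so that the last but one
   polar derivative vanishes identically; this happens only if P has a root al
   whose multiplicity, added to the number of t with t x = al, exceeds n.
   (3) By (1) and (2), f / G is increasing and has only simple poles, so f is
   real-rooted when G is, and their roots interlace; induction on n applies.
   (4) The roots of f on either side of an A-root are counted by removing from Q
   a root other than the A-root: by interlacing the count changes by at most
   one, and the leading coefficient of f / G there has the sign of t x - al. *)

Set Implicit Arguments.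
Unset Strict Implicit.
Unset Printing Implicit Defensive.

Import Order.TTheory GRing.Theory Num.Theory.

Local Open Scope ring_scope.

(** * Polar derivatives and the recursion for the composition *)

Section Polar.
Variable R : realType.
Implicit Types (P Q : {poly R}) (s ts : seq R) (n : nat).

(** The index [n] is the formal degree of [P], which may exceed the actual one; the result has
    formal degree n - 1. The ordinary derivative is the case of a pole at infinity. *)
Definition polar n (xi : R) P : {poly R} := P *+ n + (xi%:P - 'X) * P^`().

Definition linprod ts : {poly R} := \prod_(t <- ts) (1 + t *: 'X).

Lemma polarE n xi P : polar n xi P = polar n 0 P + xi *: P^`().
Proof. by rewrite /polar sub0r mulrBl mulNr -mul_polyC -addrA [- _ + _]addrC. Qed.

Lemma polarZ n xi c P : polar n xi (c *: P) = c *: polar n xi P.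
Proof. by rewrite /polar derivZ scalerMnr -scalerAr scalerDr. Qed.

Lemma coef_polar0 n P i : (i <= n)%N -> (polar n 0 P)`_i = (n - i)%:R * P`_i.
Proof.
move=> le_in; rewrite /polar sub0r mulNr coefB coefMn coefXM coef_deriv.
case: i le_in => [|i] le_in /=; first by rewrite subr0 subn0 mulr_natl.
by rewrite natrB // mulrBl !mulr_natl.
Qed.

(** The contributions n P_n and - n P_n to the coefficient of degree n cancel. *)
Lemma size_polar n xi P : (size P <= n.+1)%N -> (size (polar n xi P) <= n)%N.
Proof.
move=> /leq_sizeP P0; apply/leq_sizeP => j le_nj.
rewrite /polar mulrBl coefD coefB coefCM coefXM !coef_deriv coefMn.
rewrite (P0 j.+1) ?ltnS // mul0rn mulr0 sub0r.
case: j le_nj => [|j] le_nj /=; first by move: le_nj; rewrite leqn0 => /eqP ->; rewrite oppr0 mulr0n addr0.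
move: le_nj; rewrite leq_eqVlt => /predU1P[->|lt_nj]; first by rewrite subrr.
by rewrite P0 // !mul0rn subrr.
Qed.

(** Both sides are n(n+1) P + n(xi + eta - 2X) P' + (xi - X)(eta - X) P'', which is symmetric in the
    two poles. *)
Lemma polarC n xi eta P :
  polar n eta (polar n.+1 xi P) = polar n xi (polar n.+1 eta P).
Proof.
rewrite /polar !derivE.
ring.
Qed.

Lemma deriv_polar n xi P : (polar n.+1 xi P)^`() = polar n xi P^`().
Proof. by rewrite /polar !derivE; ring. Qed.

Local Notation S := (@schur_szego R).

Lemma coef_S n P Q i :
  (S n P Q)`_i = if (i <= n)%N then P`_i * Q`_i / 'C(n, i)%:R else 0.
Proof.
rewrite coef_poly ltnS; case: leqP => // le_in.
have C0 : 'C(n, i)%:R != 0 :> R by rewrite pnatr_eq0 -lt0n bin_gt0.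
by field.
Qed.

Lemma S_add n P1 P2 Q : S n (P1 + P2) Q = S n P1 Q + S n P2 Q.
Proof.
apply/polyP => i; rewrite coefD !coef_S; case: leqP => _; rewrite ?addr0 //.
by rewrite coefD; ring.
Qed.

Lemma S_scale n c P Q : S n (c *: P) Q = c *: S n P Q.
Proof.
apply/polyP => i; rewrite coefZ !coef_S; case: leqP => _; rewrite ?mulr0 //.
by rewrite coefZ; ring.
Qed.

Lemma S_0 n Q : S n 0 Q = 0.
Proof. by rewrite -(scale0r (0 : {poly R})) S_scale !scale0r. Qed.

Lemma S_C n P Q : S n P Q = S n Q P.
Proof. by apply/polyP => i; rewrite !coef_S (mulrC P`_i). Qed.

Lemma bin_ratio n i : (i <= n)%N ->
  (n.+1 - i)%:R / 'C(n, i)%:R = n.+1%:R / 'C(n.+1, i)%:R :> R.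
Proof.
move=> le_in; apply/eqP.
rewrite eqr_div ?pnatr_eq0 -?lt0n ?bin_gt0 // ?leqW //.
by rewrite -!natrM -mul_bin_down.
Qed.

Lemma binS_ratio n i : (i <= n)%N ->
  i.+1%:R / 'C(n, i)%:R = n.+1%:R / 'C(n.+1, i.+1)%:R :> R.
Proof.
move=> le_in; apply/eqP.
rewrite eqr_div ?pnatr_eq0 -?lt0n ?bin_gt0 //.
by rewrite -!natrM mul_bin_diag.
Qed.

(** Coefficientwise, the term 1 of the new factor weights P_i by n + 1 - i, which is the polar
    derivative at 0, and the term t X weights P_(i+1) by i + 1, which is the derivative. [bin_ratio]
    and [binS_ratio] absorb these weights in the passage from n to n + 1. *)
Lemma S_rec n t P Q : (size Q <= n.+1)%N ->
  S n.+1 P ((1 + t *: 'X) * Q) =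
  n.+1%:R^-1 *: (S n (polar n.+1 0 P) Q + t *: ('X * S n P^`() Q)).
Proof.
move=> sQ; have n1 : n.+1%:R != 0 :> R by rewrite pnatr_eq0.
have half1 i : (S n (polar n.+1 0 P) Q)`_i =
    if (i <= n.+1)%N then n.+1%:R * (P`_i * Q`_i / 'C(n.+1, i)%:R) else 0.
  rewrite coef_S; case: (ltngtP i n.+1) => [||->].
  - rewrite ltnS => le_in; rewrite le_in coef_polar0 ?leqW //.
    rewrite [RHS]mulrCA -bin_ratio //; ring.
  - by move=> gt_in; rewrite leqNgt (ltnW gt_in).
  - by rewrite ltnn (leq_sizeP _ _ sQ) // mulr0 mul0r mulr0.
have half2 i : (S n P^`() Q)`_i =
    if (i <= n)%N then n.+1%:R * (P`_i.+1 * Q`_i / 'C(n.+1, i.+1)%:R) else 0.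
  rewrite coef_S; case: leqP => // le_in.
  rewrite [RHS]mulrCA -binS_ratio // coef_deriv.
  by rewrite -mulr_natr; ring.
apply/polyP => i; rewrite coefZ coefD coefZ coefXM coef_S half1.
rewrite mulrDl mul1r coefD -scalerAl coefZ coefXM.
case: i => [|i] /=; last rewrite half2 ltnS; first by rewrite !mulr0 !addr0 mulKf.
case: leqP => _; last by rewrite !(mulr0, addr0).
apply: (mulfI n1); rewrite mulVKf //; set c := _%:R^-1; ring.
Qed.

(** At a given point the two terms merge into one polar derivative. Its pole t x depends on the
    point, so this is an identity of values and not of polynomials. *)
Lemma horner_S_rec n t P Q x : (size Q <= n.+1)%N ->
  (S n.+1 P ((1 + t *: 'X) * Q)).[x] =
  n.+1%:R^-1 * (S n (polar n.+1 (t * x) P) Q).[x].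
Proof.
by move=> sQ; rewrite S_rec // (polarE _ (t * x)) S_add S_scale !(hornerZ, hornerD, hornerM, hornerX) mulrA.
Qed.

Lemma deriv_S n P Q : (S n.+1 P Q)^`() = n.+1%:R^-1 *: S n P^`() Q^`().
Proof.
have n1 : n.+1%:R != 0 :> R by rewrite pnatr_eq0.
apply/polyP => i; rewrite coefZ coef_deriv !coef_S ltnS.
case: leqP => le_in; last by rewrite mul0rn mulr0.
rewrite !coef_deriv -(mulr_natl (_ / _)) -(mulr_natl P`_i.+1) -(mulr_natl Q`_i.+1); apply: (mulfI n1); rewrite mulVKf //.
have := binS_ratio le_in; set c := _%:R^-1; set d := _%:R^-1; set k := i.+1%:R => E.
rewrite (_ : k * _ * _ * _ = P`_i.+1 * Q`_i.+1 * k * (k * c)); last by ring.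
by rewrite E; ring.
Qed.

Lemma size_S n P Q : (size (S n P Q) <= n.+1)%N.
Proof. exact: size_poly. Qed.

Lemma size_linprod ts : (size (linprod ts) <= (size ts).+1)%N.
Proof.
rewrite /linprod; elim: ts => [|t ts IH]; first by rewrite big_nil size_poly1.
rewrite big_cons (leq_trans (size_polyMleq _ _)) //.
have : (size (1 + t *: 'X)%R <= 2)%N.
  rewrite (leq_trans (size_polyD _ _)) // geq_max size_poly1.
  by rewrite (leq_trans (size_scale_leq _ _)) // size_polyX.
move=> h; move: (leq_add h IH); rewrite -subn1 leq_subLR add1n => /leq_trans; apply; exact: leqnn.
Qed.

Lemma S_0_linprod P : S 0 P (linprod [::]) = (P`_0)%:P.
Proof.
apply/polyP => -[|i]; rewrite coef_S coefC //=.
by rewrite /linprod big_nil coef1 mulr1 divr1.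
Qed.

(** The zero polynomial is included, because polar derivatives may vanish identically. *)
Definition splits P := exists s, P = lead_coef P *: \prod_(a <- s) ('X - a%:P).

Lemma splits_prod k s : splits (k *: \prod_(a <- s) ('X - a%:P)).
Proof.
by exists s; rewrite lead_coefZ (monicP (monic_prod_XsubC _ _ _)) mulr1.
Qed.

Lemma splits0 : splits 0.
Proof. by exists [::]; rewrite lead_coef0 scale0r. Qed.

End Polar.

(** * Real-rootedness of polar derivatives *)

Section LogDeriv.
Variable F : fieldType.
Implicit Types (s : seq F) (z : F).

Lemma horner_prod_XsubC_neq0 s z :
  z \notin s -> (\prod_(a <- s) ('X - a%:P)).[z] != 0.
Proof. by rewrite -root_prod_XsubC. Qed.

Lemma log_deriv s z : z \notin s -> let p := \prod_(a <- s) ('X - a%:P) in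
  p^`().[z] = p.[z] * \sum_(a <- s) (z - a)^-1 /\
  p^`()^`().[z] = p.[z] * ((\sum_(a <- s) (z - a)^-1) ^+ 2 - \sum_(a <- s) (z - a)^-1 ^+ 2).
Proof.
move=> + p; rewrite {}/p; elim: s => [|a s IH].
  by rewrite !big_nil !derivC horner0 expr0n subr0 mulr0.
rewrite inE negb_or => /andP[za /IH [E1 E2]].
have za0 : z - a != 0 by rewrite subr_eq0.
rewrite !big_cons; set p := \prod_(_ <- s) _ in E1 E2 *.
rewrite !derivE !(hornerD, hornerM, hornerX, hornerC, hornerN) E1 E2; split; field; exact: za0.
Qed.

End LogDeriv.

(* The hypotheses say that sum |x - b|^2 + (n - size w) |b|^2 = 0. *)
Lemma eq_of_sum_sqr (F : numFieldType) (cj : {rmorphism F -> F}) (w : seq F) n b :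
  (forall x, 0 <= x * cj x) -> (size w <= n)%N ->
  \sum_(x <- w) x = n%:R * b -> \sum_(x <- w) x * cj x = n%:R * (b * cj b) ->
  {in w, forall x, x = b} /\ (b != 0 -> size w = n).
Proof.
move=> cj_ge0 le_wn sum1 sum2.
have cj0 x : x * cj x = 0 -> x = 0.
  by move/eqP; rewrite mulf_eq0 fmorph_eq0 orbb => /eqP.
have sum1' : \sum_(x <- w) cj x = n%:R * cj b.
  by rewrite -rmorph_sum sum1 rmorphM rmorph_nat.
have E : \sum_(x <- w) (x - b) * cj (x - b) + (n - size w)%:R * (b * cj b) = 0.
  have -> : \sum_(x <- w) (x - b) * cj (x - b) =
     \sum_(x <- w) x * cj x - (\sum_(x <- w) x) * cj b - b * (\sum_(x <- w) cj x)
       + (size w)%:R * (b * cj b).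
    elim: (w) => [|x w' IH] /=; first by rewrite !big_nil !(mul0r, mulr0, subr0, addr0).
    by rewrite !big_cons IH rmorphB -[(size w').+1%:R]natr1; ring.
  by rewrite natrB // sum2 sum1 sum1'; ring.
have ge1 : 0 <= \sum_(x <- w) (x - b) * cj (x - b) by apply: sumr_ge0.
have ge2 : 0 <= (n - size w)%:R * (b * cj b) by rewrite mulr_ge0.
move/eqP: E; rewrite paddr_eq0 // psumr_eq0 // => /andP[/allP all0 /eqP E2]; split.
  by move=> x /all0 /eqP /cj0 /eqP; rewrite subr_eq0 => /eqP.
move=> b0; move/eqP: E2; rewrite mulf_eq0 pnatr_eq0 => /orP[|/eqP/cj0/eqP].
  by rewrite subn_eq0 => h; apply/eqP; rewrite eqn_leq le_wn.
by rewrite (negPf b0).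
Qed.

Section RealRoots.
Variable R : realType.
Implicit Types (P Q : {poly R}) (s ts : seq R) (n : nat).
Local Notation toC := (real_complex R).

Lemma splits_complex P :
  (forall z : R[i], root (map_poly toC P) z -> exists x, z = toC x) -> splits P.
Proof.
have [->|P0] := eqVneq P 0; first by move=> _; apply: splits0.
move=> realP; have [r Er] := closed_field_poly_normal (map_poly toC P).
have lc0 : lead_coef (map_poly toC P) != 0 by rewrite lead_coef_eq0 map_poly_eq0.
pose f := @complex.Re R.
have Ef : forall z : R[i], z \in r -> z = toC (f z).
  move=> z zr; have [|x ->] // := realP z.
  by rewrite Er rootE hornerZ mulf_eq0 -rootE root_prod_XsubC zr orbT.
exists (map f r); apply: (map_poly_inj toC).
rewrite map_polyZ /= -lead_coef_map {1}Er; congr (_ *: _).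
rewrite rmorph_prod big_map /= big_seq [RHS]big_seq; apply: eq_bigr => z zr.
by rewrite rmorphB /= map_polyX map_polyC /= -Ef.
Qed.

Lemma splits_root P z : splits P -> P != 0 -> root (map_poly toC P) z ->
  exists x, z = toC x.
Proof.
move=> [s EP] P0; rewrite EP map_polyZ rootE hornerZ mulf_eq0 /= fmorph_eq0.
rewrite lead_coef_eq0 (negPf P0) /= rmorph_prod -rootE.
under eq_bigr do rewrite rmorphB /= map_polyX map_polyC /=.
rewrite (_ : \prod_(a <- s) _ = \prod_(a <- map toC s) ('X - a%:P)); last by rewrite big_map.
by rewrite root_prod_XsubC => /mapP[x _ ->]; exists x.
Qed.

Lemma conj_toC (a : R) : (toC a)^* = toC a.
Proof. by apply/CrealP/complex_realP; exists a. Qed.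

(* To be used with b = 1 / (z - xi) for the polar derivative with respect to xi,
   and with b = 0 for the ordinary one (xi = infinity). *)
Lemma nonreal_log_deriv s n z (b : R[i]) : z != z^* -> (size s <= n)%N ->
  b - b^* = (z^* - z) * (b * b^*) ->
  \sum_(a <- s) (z - toC a)^-1 = n%:R * b ->
  {in s, forall a, (z - toC a)^-1 = b} /\ (b != 0 -> size s = n).
Proof.
move=> nrz le_sn Eb Es.
pose w := [seq (z - toC a)^-1 | a <- s].
(* For real a, the numbers 1/(z - a) lie on one circle through 0, and so does [b]. Summing its
   equation turns the linear hypothesis into the value of the sum of |x|^2. *)
have Ew x : x \in w -> x - x^* = (z^* - z) * (x * x^*).
  case/mapP => a _ ->; rewrite fmorphV rmorphB /= conj_toC.
  have nz : z - toC a != 0.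
    by apply: contraNneq nrz => /eqP; rewrite subr_eq0 => /eqP->; rewrite conj_toC.
  have nz' : z^* - toC a != 0.
    by rewrite -(conj_toC a) -rmorphB fmorph_eq0.
  by field; rewrite nz nz'.
have sum1 : \sum_(x <- w) x = n%:R * b by rewrite big_map.
have sum2 : \sum_(x <- w) x * x^* = n%:R * (b * b^*).
  apply: (@mulfI _ (z^* - z)); first by rewrite subr_eq0 eq_sym.
  rewrite mulrCA -Eb mulr_sumr mulrBr -sum1.
  have -> : n%:R * b^* = \sum_(x <- w) x^*.
    by rewrite -rmorph_sum sum1 rmorphM /= rmorph_nat.
  by rewrite -sumrB; apply: eq_big_seq => x /Ew.
have [] := @eq_of_sum_sqr _ Num.conj w n b _ _ sum1 sum2.
- by move=> x; apply: mul_conjC_ge0.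
- by rewrite size_map.
rewrite size_map => h1 h2; split=> // a sa; apply: h1; exact: map_f.
Qed.

Lemma nonreal_horner s z : z != z^* ->
  let p := \prod_(a <- s) ('X - (toC a)%:P) in
  p.[z] != 0 /\ p^`().[z] = p.[z] * \sum_(a <- s) (z - toC a)^-1.
Proof.
move=> nrz p; have -> : p = \prod_(a <- map toC s) ('X - a%:P) by rewrite big_map.
have zs : z \notin map toC s.
  by apply: contra nrz => /mapP[a _ ->]; rewrite conj_toC.
split; first exact: horner_prod_XsubC_neq0.
by have [-> _] := log_deriv zs; congr (_ * _); rewrite big_map.
Qed.

Lemma map_prod_XsubC s : map_poly toC (\prod_(a <- s) ('X - a%:P)) =
  \prod_(a <- s) ('X - (toC a)%:P).
Proof.
rewrite rmorph_prod; apply: eq_bigr => a _.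
by rewrite rmorphB /= map_polyX map_polyC.
Qed.

(** The derivative of (X - xi)^m times xi - X is - m (X - xi)^m, which turns the factor n into n -
    m. *)
Lemma polar_XsubCX n m (xi : R) P : (m <= n)%N ->
  polar n xi (('X - xi%:P) ^+ m * P) = ('X - xi%:P) ^+ m * polar (n - m) xi P.
Proof.
move=> le_mn; rewrite /polar derivM deriv_exp derivXsubC mul1r.
have -> : n = (n - m + m)%N by rewrite subnK.
rewrite addnK mulrnDr; case: m {le_mn} => [|m]; first by rewrite !expr0 mulr0n; ring.
by rewrite /= exprS; ring.
Qed.

Lemma polar_XsubCX0 n (xi k : R) : polar n xi (k *: ('X - xi%:P) ^+ n) = 0.
Proof.
rewrite -mul_polyC mulrC polar_XsubCX // subnn /polar mulr0n derivC.
by rewrite mulr0 addr0 mulr0.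
Qed.

(** A non-real root z would give sum 1/(z - a) = n/(z - xi) over the roots a of P. The equality case
    then makes every a equal to xi and their number equal to n, so that the polar derivative is
    0. *)
Lemma splits_polar n xi P : splits P -> (size P <= n.+1)%N ->
  splits (polar n xi P).
Proof.
move=> [s EP] szP; have [P0|P0] := eqVneq (lead_coef P) 0.
  move: P0 => /eqP; rewrite lead_coef_eq0 => /eqP ->.
  by rewrite /polar mul0rn derivC mulr0 addr0; apply: splits0.
move: (lead_coef P) P0 EP => k k0 EP.
move: szP; rewrite EP size_scale // size_prod_XsubC ltnS => le_sn.
have [->|q0] := eqVneq (polar n xi (k *: \prod_(a <- s) ('X - a%:P))) 0; first exact: splits0.
apply: splits_complex => z rz; suff: z \is Num.real by move/complex_realP.
apply/CrealP/eqP; rewrite eq_sym; apply: contraNT q0 => nrz.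
have [p0 Ep'] := nonreal_horner s nrz.
have zxi : z - toC xi != 0.
  by apply: contraNneq nrz => /eqP; rewrite subr_eq0 => /eqP->; rewrite conj_toC.
have zxi' : z^* - toC xi != 0.
  by rewrite -(conj_toC xi) -rmorphB fmorph_eq0.
have [||||h1 h2] := @nonreal_log_deriv s n z (z - toC xi)^-1 => //.
- by rewrite fmorphV rmorphB /= conj_toC; field; rewrite zxi zxi'.
- move: rz; rewrite polarZ map_polyZ rootE hornerZ mulf_eq0 fmorph_eq0 (negPf k0) /=.
  rewrite /polar rmorphD rmorphM rmorphMn rmorphB /= -deriv_map map_prod_XsubC map_polyX map_polyC /=.
  rewrite hornerD hornerM hornerMn hornerD hornerN hornerX hornerC Ep' -mulr_natl => /eqP E.
  apply: (mulfI p0); apply: (mulIf zxi); rewrite -!mulrA mulVf // mulr1 [RHS]mulrC.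
  by move/eqP: E; rewrite addr_eq0 => /eqP ->; ring.
have {}h2 := h2 (invr_neq0 zxi).
have {}h1 : {in s, forall a, a = xi}.
  move=> a /h1 /(congr1 GRing.inv); rewrite !invrK => /eqP.
  by rewrite (inj_eq (addrI z)) eqr_opp => /eqP/complexI.
rewrite big_seq (eq_bigr (fun=> 'X - xi%:P)) => [|a /h1-> //].
by rewrite -big_seq big_const_seq count_predT iter_mulr_1 h2 polar_XsubCX0.
Qed.

(** The same argument with the pole at infinity: at a non-real root every 1/(z - a) would be 0. *)
Lemma splits_deriv P : splits P -> splits P^`().
Proof.
move=> [s EP]; have [P0|P0] := eqVneq (lead_coef P) 0.
  move: P0 => /eqP; rewrite lead_coef_eq0 => /eqP ->.
  by rewrite derivC; apply: splits0.
move: (lead_coef P) P0 EP => k k0 ->.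
case: s => [|a s]; first by rewrite big_nil derivZ derivC scaler0; exact: splits0.
apply: splits_complex => z rz; suff: z \is Num.real by move/complex_realP.
apply/CrealP/eqP; rewrite eq_sym; apply/negPn/negP => nrz.
have [p0 Ep'] := nonreal_horner (a :: s) nrz.
have [||||h1 _] := @nonreal_log_deriv (a :: s) (size (a :: s)) z 0 => //.
- by rewrite rmorph0 subr0 !mulr0.
- move: rz; rewrite derivZ map_polyZ rootE hornerZ mulf_eq0 fmorph_eq0 (negPf k0) /=.
  by rewrite -deriv_map map_prod_XsubC Ep' mulf_eq0 (negPf p0) mulr0 => /eqP.
have /eqP := h1 a (mem_head _ _); rewrite invr_eq0 subr_eq0 => /eqP Ez.
by move: nrz; rewrite Ez conj_toC eqxx.
Qed.

End RealRoots.

(** * The Wronskian inequality *)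

Section Wronskian.
Variable R : realType.
Implicit Types (P Q : {poly R}) (s ts : seq R) (n : nat).
Local Notation S := (@schur_szego R).
Local Notation polar := (@polar R).
Local Notation linprod := (@linprod R).

Lemma linprod_cons t ts : linprod (t :: ts) = (1 + t *: 'X) * linprod ts.
Proof. by rewrite /linprod big_cons. Qed.

Lemma splits_discr P : splits P -> (size P <= 3)%N ->
  4%:R * (P`_0 * P`_2) <= P`_1 ^+ 2.
Proof.
move=> [s ->]; have [-> _|k0] := eqVneq (lead_coef P) 0.
  by rewrite scale0r !coef0; lra.
rewrite size_scale // size_prod_XsubC.
case: s => [|a [|b []]] // _; rewrite ?big_cons big_nil ?mulr1.
- by rewrite !coefZ !coef1 /=; lra.
- by rewrite !coefZ !coefB !coefX !coefC /=; set k := lead_coef P; nra.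
- have -> : ('X - a%:P) * ('X - b%:P) = 'X^2 - (a + b) *: 'X + (a * b)%:P.
    by rewrite -mul_polyC polyCD polyCM; ring.
  rewrite !(coefZ, coefD, coefB, coefN, coefXn, coefX, coefC) /=.
  set k := lead_coef P; rewrite -subr_ge0 (_ : _ - _ = (k * (a - b)) ^+ 2) ?sqr_ge0 //; ring.
Qed.

(** By the recursion, each [t] replaces [P] by its polar derivative at t x, which stays real-rooted.
    What remains is the discriminant inequality for a real-rooted polynomial of formal degree 2. *)
Lemma discr_ge0 ts P x : splits P -> (size P <= (size ts).+3)%N ->
  let l n p := (S n p (linprod ts)).[x] in let n := size ts in
  l n (polar n.+1 0 (polar n.+2 0 P)) * l n P^`()^`() <= l n (polar n.+1 0 P^`()) ^+ 2.
Proof.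
move=> + + /=; elim: ts P => [|t ts IH] P sP szP /=.
  rewrite !S_0_linprod !hornerC !coef_polar0 //= !coef_deriv !mul1r.
  rewrite -subr_ge0; have := splits_discr sP szP; rewrite -subr_ge0.
  by congr (0 <= _); rewrite ?subn0 ?subSS ?mulr1n; ring.
set k := size ts.
have szQ : (size (linprod ts) <= k.+1)%N by exact: size_linprod.
rewrite !linprod_cons !horner_S_rec //.
(* Commutation moves the polar derivative at t x next to [P], where the induction hypothesis
   applies. *)
rewrite (polarC k.+1) (polarC k.+2) (polarC k.+1) -!deriv_polar.
have := IH (polar k.+3 (t * x) P) (splits_polar (t * x) sP szP) (size_polar (t * x) szP).
rewrite -/k -deriv_polar; set a := _.[x]; set b := _.[x]; set d := _.[x] => h.
rewrite mulrACA exprMn -expr2; exact: (ler_wpM2l (sqr_ge0 _) h).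
Qed.

Lemma linprod_nth ts i : (i < size ts)%N ->
  linprod ts = (1 + ts`_i *: 'X) * linprod (take i ts ++ drop i.+1 ts).
Proof.
move=> lt_i; rewrite -[in LHS](cat_take_drop i ts) (drop_nth 0) //.
by rewrite /linprod !big_cat /= big_cons mulrCA.
Qed.

Lemma deriv_linprod ts : (linprod ts)^`() =
  \sum_(i < size ts) ts`_i *: linprod (take i ts ++ drop i.+1 ts).
Proof.
elim: ts => [|t ts IH]; first by rewrite /linprod big_nil derivC big_ord0.
rewrite linprod_cons derivM IH big_ord_recl /= drop0; congr (_ + _).
  by rewrite !derivE add0r -scalerAl mul1r.
rewrite mulr_sumr; apply: eq_bigr => i _.
by rewrite linprod_cons scalerAr.
Qed.

(** Let A_i, B_i, D_i be the values of the three compositions of [discr_ge0] for [ts] without t_i,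
    and c = 1/size ts. Then K = c (A_i + t_i x B_i) and G = c (B_i + t_i x D_i) for every i, while
    K' = c sum t_i B_i and G' = c sum t_i D_i. Hence the Wronskian is c^2 sum t_i (B_i^2 - A_i
    D_i). *)
Lemma wronskian_ge0 ts P x : splits P -> (size P <= (size ts).+2)%N ->
  {in ts, forall t, 0 <= t} ->
  let K := S (size ts) (polar (size ts).+1 0 P) (linprod ts) in
  let G := S (size ts) P^`() (linprod ts) in
  0 <= K^`().[x] * G.[x] - K.[x] * G^`().[x].
Proof.
move=> sP szP pos /=; case E: (size ts) szP => [|m] szP.
  have S0 p Q : (S 0 p Q)^`() = 0.
    by apply/polyP => i; rewrite coef_deriv coef_S coef0 mul0rn.
  by rewrite !S0 horner0 mul0r mulr0 subrr.
rewrite !deriv_S deriv_linprod (deriv_polar m.+1).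
pose l i p := (S m p (linprod (take i ts ++ drop i.+1 ts))).[x].
have sumE p : (S m p (\sum_(i < size ts) ts`_i *: linprod (take i ts ++ drop i.+1 ts))).[x]
   = \sum_(i < size ts) ts`_i * l i p.
  rewrite S_C; elim/big_rec2: _ => [|i y q _ <-]; first by rewrite S_0 horner0.
  by rewrite S_add S_scale hornerD hornerZ S_C.
have recE p i : (i < size ts)%N -> (S m.+1 p (linprod ts)).[x] =
   m.+1%:R^-1 * (l i (polar m.+1 0 p) + ts`_i * x * l i p^`()).
  move=> lt_i; rewrite (linprod_nth lt_i) horner_S_rec; last first.
    apply: leq_trans (size_linprod _) _.
    by rewrite size_cat size_takel ?(ltnW lt_i) // size_drop; lia.
  by rewrite (polarE _ (_ * x)) S_add S_scale hornerD hornerZ.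
rewrite !hornerZ !sumE.
set G := (S _ _ _).[x]; set K := (S _ _ _).[x].
have -> : m.+1%:R^-1 * (\sum_(i < size ts) ts`_i * l i (polar m.+1 0 P^`())) * G
 - K * (m.+1%:R^-1 * (\sum_(i < size ts) ts`_i * l i P^`()^`())) =
  m.+1%:R^-1 * \sum_(i < size ts) ts`_i * (l i (polar m.+1 0 P^`()) * G - K * l i P^`()^`()).
  rewrite -mulrA (mulrCA K) -mulrBr; congr (_ * _); rewrite mulr_suml mulr_sumr -sumrB.
  by apply: eq_bigr => i _; ring.
rewrite mulr_ge0 ?invr_ge0 ?ler0n // sumr_ge0 // => i _.
apply: mulr_ge0; first by rewrite pos ?mem_nth.
rewrite /K /G !(recE _ _ (ltn_ord i)) (deriv_polar m.+1).
set A := l _ (polar _ _ (polar _ _ _)); set B := l _ _; set D := l _ _.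
have -> : B * (m.+1%:R^-1 * (B + ts`_i * x * D)) - m.+1%:R^-1 * (A + ts`_i * x * B) * D =
  m.+1%:R^-1 * (B ^+ 2 - A * D) by ring.
rewrite mulr_ge0 ?invr_ge0 ?ler0n // subr_ge0.
have szi : size (take i ts ++ drop i.+1 ts) = m.
  by have := ltn_ord i; rewrite size_cat size_takel ?(ltnW (ltn_ord i)) // size_drop; lia.
have := @discr_ge0 (take i ts ++ drop i.+1 ts) P x sP.
by rewrite szi; apply.
Qed.

(** With c = 1/(size ts + 1) one has f = c (K + t X G), so the Wronskian of f and G is c times that
    of K and G, plus c t G^2. *)
Lemma wronskian_gt0 t ts P x : splits P -> (size P <= (size ts).+2)%N ->
  0 < t -> {in ts, forall t, 0 <= t} ->
  let f := S (size ts).+1 P (linprod (t :: ts)) in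
  let G := S (size ts) P^`() (linprod ts) in
  t / (size ts).+1%:R * G.[x] ^+ 2 <= f^`().[x] * G.[x] - f.[x] * G^`().[x].
Proof.
move=> sP szP t0 pos /=.
have /= := wronskian_ge0 x sP szP pos.
rewrite linprod_cons S_rec ?size_linprod //; set K := S _ (polar _ _ _) _.
set G := S _ _ _; rewrite !derivE !(hornerZ, hornerD, hornerM, hornerX, hornerC) => h.
have c0 : 0 <= (size ts).+1%:R^-1 :> R by rewrite invr_ge0 ler0n.
have := mulr_ge0 c0 h; rewrite -[in X in _ -> X]subr_ge0; set c := _^-1; congr (0 <= _); ring.
Qed.

End Wronskian.

(** * Multiplicities *)

Section Multiplicity.
Variable R : realType.
Implicit Types (P Q : {poly R}) (s ts : seq R) (n : nat).
Local Notation S := (@schur_szego R).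

Lemma mup_gt0 x P : P != 0 -> (0 < mup x P)%N = root P x.
Proof. by move=> P0; rewrite -XsubC_dvd // dvdp_XsubCl. Qed.

Lemma mup_XsubCM x m P : ~~ root P x -> mup x (('X - x%:P) ^+ m * P) = m.
Proof. by move=> Px; rewrite mupMl // mup_XsubCX eqxx. Qed.

Lemma mup_factor x P : P != 0 ->
  exists2 Q, ~~ root Q x & P = ('X - x%:P) ^+ mup x P * Q.
Proof.
move=> P0; have [m [Q]] := multiplicity_XsubC P x; rewrite P0 /= => Qx EP.
by exists Q; rewrite // {2}EP (mulrC Q) mup_XsubCM // mulrC.
Qed.

Lemma mupZ x k P : k != 0 -> mup x (k *: P) = mup x P.
Proof. by move=> k0; rewrite -mul_polyC mupMr // rootC. Qed.

Lemma mup_size x P n : P != 0 -> (size P <= n.+1)%N -> (mup x P <= n)%N.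
Proof.
move=> P0 szP; have [Q Qx EP] := mup_factor x P0.
have Q0 : Q != 0 by apply: contraNneq Qx => ->; rewrite root0.
rewrite -ltnS; apply: leq_trans szP; rewrite {2}EP size_monicM ?monic_exp ?monicXsubC //.
by rewrite size_exp_XsubC addSn /= -[X in (X < _)%N]addn0 ltn_add2l size_poly_gt0.
Qed.

Lemma mup_deriv x P : P != 0 -> root P x -> mup x P = (mup x P^`()).+1.
Proof.
move=> P0; rewrite -mup_gt0 //; have [Q Qx EP] := mup_factor x P0.
case: (mup x P) EP => // m -> _.
set D := 'X - x%:P.
have -> : (D ^+ m.+1 * Q)^`() = D ^+ m * (Q *+ m.+1 + D * Q^`()).
  by rewrite derivM deriv_exp derivXsubC mul1r /= exprS; ring.
rewrite mup_XsubCM // rootE !hornerE subrr mul0r addr0.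
by rewrite hornerMn mulrn_eq0.
Qed.

Lemma horner_polar n xi x P :
  (polar n xi P).[x] = n%:R * P.[x] + (xi - x) * P^`().[x].
Proof. by rewrite /polar hornerD hornerM hornerMn hornerD hornerN hornerX hornerC mulr_natl. Qed.

(** Off the pole, (xi - X) P' has lower order at al than n P, so the polar derivative acts on the
    multiplicity like the ordinary one. *)
Lemma mup_polar_neq n al xi P : P != 0 -> root P al -> al != xi ->
  mup al P = (mup al (polar n xi P)).+1.
Proof.
move=> P0; rewrite -mup_gt0 // => + al_xi; have [Q Qx EP] := mup_factor al P0.
case: (mup al P) EP => // m -> _; set D := 'X - al%:P.
have -> : polar n xi (D ^+ m.+1 * Q) = D ^+ m *
  (D * Q *+ n + (xi%:P - 'X) * (Q *+ m.+1 + D * Q^`())).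
  by rewrite /polar derivM deriv_exp derivXsubC mul1r /= exprS; ring.
rewrite mup_XsubCM // rootE !hornerE hornerMn !hornerE subrr !mul0r mul0rn add0r addr0.
by rewrite hornerMn mulf_neq0 ?mulrn_eq0 // subr_eq0 eq_sym.
Qed.

(** After (X - xi)^m is taken out, the cofactor has the value (n - m) Q(xi) at xi. If m = n, then Q
    is constant and the polar derivative is 0. *)
Lemma mup_polar_eq n xi P : P != 0 -> (size P <= n.+1)%N -> polar n xi P != 0 ->
  mup xi (polar n xi P) = mup xi P.
Proof.
move=> P0 szP; have [Q Qx EP] := mup_factor xi P0.
have le_mn := mup_size xi P0 szP.
rewrite {1 2}EP polar_XsubCX // => p0; rewrite mup_XsubCM //.
rewrite rootE horner_polar subrr mul0r addr0 mulf_neq0 // pnatr_eq0 subn_eq0 -ltnNge.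
rewrite ltn_neqAle le_mn andbT; apply: contraNneq p0 => E.
have szQ : (size Q <= 1)%N.
  have Q0 : Q != 0 by apply: contraNneq Qx => ->; rewrite root0.
  move: szP; rewrite EP size_monicM ?monic_exp ?monicXsubC // size_exp_XsubC E /=.
  by rewrite -addn1 leq_add2l.
by rewrite E subnn /polar mulr0n (size1_polyC szQ) derivC mulr0 addr0 mulr0.
Qed.

Lemma polar_eq0 n xi P : P != 0 -> (size P <= n.+1)%N -> polar n xi P = 0 ->
  mup xi P = n.
Proof.
move=> P0 szP; have [Q Qx EP] := mup_factor xi P0.
have le_mn := mup_size xi P0 szP.
rewrite {1}EP polar_XsubCX // => /eqP; rewrite mulf_eq0 expf_eq0 polyXsubC_eq0 andbF /=.
move=> /eqP /(congr1 (horner^~ xi)); rewrite horner_polar subrr mul0r addr0 horner0 => /eqP.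
rewrite mulf_eq0 pnatr_eq0 subn_eq0 -rootE (negPf Qx) orbF => le_nm.
by apply/eqP; rewrite eqn_leq le_mn.
Qed.

Lemma splits_log_deriv P x : splits P -> ~~ root P x ->
  exists s, [/\ size P = (size s).+1, lead_coef P != 0,
    P = lead_coef P *: \prod_(a <- s) ('X - a%:P),
    P^`().[x] = P.[x] * \sum_(a <- s) (x - a)^-1 &
    P^`()^`().[x] = P.[x] * ((\sum_(a <- s) (x - a)^-1) ^+ 2 - \sum_(a <- s) (x - a)^-1 ^+ 2)].
Proof.
move=> [s EP] Px; have P0 : lead_coef P != 0.
  by rewrite lead_coef_eq0; apply: contraNneq Px => ->; rewrite root0.
exists s; move: (lead_coef P) P0 EP Px => k k0 ->.
rewrite rootE hornerZ mulf_eq0 negb_or => /andP[_ px].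
rewrite size_scale // size_prod_XsubC; split=> //; rewrite !derivZ !hornerZ -mulrA.
  by rewrite (log_deriv _).1 // -root_prod_XsubC.
by rewrite (log_deriv _).2 // -root_prod_XsubC.
Qed.

(** With d = xi - al, the two vanishing conditions give sum 1/(al - a) = - n/d and sum 1/(al - a)^2
    = n/d^2 over the roots a of P. The equality case forces P = k (X - xi)^n. *)
Lemma double_root_polar n xi al P : splits P -> (size P <= n.+1)%N ->
  ~~ root P al -> root (polar n xi P) al -> root (polar n xi P)^`() al ->
  polar n xi P = 0.
Proof.
move=> sP szP Pal; have [s [szs k0 EP E1 E2]] := splits_log_deriv sP Pal.
move: szP; rewrite szs ltnS => le_sn.
case: n le_sn => [|n] le_sn.
  case: s le_sn {szs E1 E2} EP => // _ ->; rewrite big_nil /polar mulr0n derivZ derivC.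
  by rewrite scaler0 mulr0 addr0.
rewrite deriv_polar !rootE !horner_polar E1 E2.
set p := P.[al] in E1 E2 *; have p0 : p != 0 by [].
set s1 := \sum_(a <- s) _; set s2 := \sum_(a <- s) _; set d := xi - al => H1 H2.
have d0 : d != 0.
  by apply: contraTneq H1 => ->; rewrite mul0r addr0 mulf_neq0 // pnatr_eq0.
have Es1 : s1 = n.+1%:R * (- d^-1).
  apply: (mulfI p0); apply: (mulfI d0); apply/eqP; rewrite -subr_eq0.
  rewrite -(eqP H1) eq_sym; apply/eqP; field; exact: d0.
have Es2 : s2 = n.+1%:R * (- d^-1) ^+ 2.
  apply: (mulfI p0); apply: (mulfI d0); apply/eqP; rewrite -subr_eq0.
  rewrite -(oppr0 R) -(eqP H2) Es1; apply/eqP; field; exact: d0.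
(* The real form of the equality case: the identity takes the place of conjugation. *)
have [||||h1 h2] := @eq_of_sum_sqr R idfun [seq (al - a)^-1 | a <- s] n.+1 (- d^-1).
- by move=> x; rewrite -expr2 sqr_ge0.
- by rewrite size_map.
- by rewrite big_map.
- by rewrite big_map.
have {h2} : size s = n.+1 by rewrite -(size_map (fun a => (al - a)^-1)) h2 // oppr_eq0 invr_eq0.
have {}h1 : {in s, forall a, a = xi}.
  move=> a sa; have := h1 _ (map_f _ sa); rewrite -invrN => /invr_inj.
  by rewrite /d opprB => /(addrI al) /oppr_inj.
move=> sz; rewrite EP big_seq (eq_bigr (fun=> 'X - xi%:P)) => [|a /h1-> //].
by rewrite -big_seq big_const_seq count_predT iter_mulr_1 sz polar_XsubCX0.
Qed.

(** Since P''/P = (P'/P)^2 - sum 1/(al - a)^2, the sum of squares is 0, so P has no root and is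
    constant. *)
Lemma double_root_deriv al P : splits P ->
  ~~ root P al -> root P^`() al -> root P^`()^`() al -> P^`() = 0.
Proof.
move=> sP Pal; have [s [szs k0 EP E1 E2]] := splits_log_deriv sP Pal.
rewrite !rootE E1 E2 !mulf_eq0 -rootE (negPf Pal) /= => /eqP -> .
rewrite expr0n sub0r oppr_eq0 psumr_eq0 => [/allP h|a _]; last by rewrite sqr_ge0.
case: s h {szs E1 E2} EP => [_ ->|a s h EP].
  by rewrite big_nil derivZ derivC scaler0.
have /implyP/(_ isT) := h a (mem_head _ _); rewrite sqrf_eq0 invr_eq0 subr_eq0 => /eqP ala.
move: Pal; rewrite EP ala rootE hornerZ mulf_eq0 -rootE root_prod_XsubC mem_head orbT //.
Qed.


Lemma multiple_root_deriv x P : P != 0 -> (1 < mup x P)%N -> root P x /\ root P^`() x.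
Proof.
move=> P0 m1; have rx : root P x by rewrite -mup_gt0 // ltnW.
split=> //; have := mup_deriv P0 rx => E; move: m1; rewrite E ltnS.
have [->|P'0] := eqVneq P^`() 0; first by rewrite root0.
by rewrite mup_gt0.
Qed.

Lemma mup_multiple_polar n xi al P : splits P -> (size P <= n.+1)%N ->
  polar n xi P != 0 -> (1 < mup al (polar n xi P))%N -> al != xi ->
  mup al P = (mup al (polar n xi P)).+1.
Proof.
move=> sP szP p0 m1 al_xi; have P0 : P != 0.
  by apply: contraNneq p0 => ->; rewrite /polar mul0rn derivC mulr0 addr0.
have [r0 r1] := multiple_root_deriv p0 m1.
apply: mup_polar_neq => //; apply: contraNT p0 => Pal.
by rewrite (double_root_polar sP szP Pal).
Qed.

Lemma mup_multiple_deriv al P : splits P -> P^`() != 0 ->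
  (1 < mup al P^`())%N -> mup al P = (mup al P^`()).+1.
Proof.
move=> sP p0 m1; have P0 : P != 0 by apply: contraNneq p0 => ->; rewrite derivC.
have [r0 r1] := multiple_root_deriv p0 m1.
apply: mup_deriv => //; apply: contraNT p0 => Pal.
by rewrite (double_root_deriv sP Pal).
Qed.

End Multiplicity.

(** * A-roots *)

Section ARoots.
Variable R : realType.
Implicit Types (P Q : {poly R}) (s ts : seq R) (n : nat).
Local Notation S := (@schur_szego R).

(** The hypothesis says that the polynomial of formal degree 1 left after the polar derivatives at
    all t x vanishes. Undoing one of them, at t x, keeps the multiplicity of al = t x but adds 1 to
    the count, and raises the multiplicity of any other al by 1. If the first polar derivative is
    already 0, then P is a multiple of a power of X - t x. *)
Lemma common_polar_root ts P x : splits P -> P != 0 -> (size P <= (size ts).+2)%N ->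
  (forall z, (S (size ts) (polar (size ts).+1 z P) (linprod ts)).[x] = 0) ->
  exists al, ((size ts).+1 < mup al P + count (fun t => (t * x)%R == al) ts)%N.
Proof.
elim: ts P => [|t ts IH] P sP P0 szP /= H.
  suff : P = 0 by move/eqP: P0.
  have Pz z : P`_0 + z * P`_1 = 0.
    by have := H z; rewrite S_0_linprod hornerC polarE coefD coef_polar0 // mul1r coefZ coef_deriv.
  have P00 : P`_0 = 0 by have := Pz 0; rewrite mul0r addr0.
  apply/polyP => -[|[|i]]; rewrite coef0 //.
    by have := Pz 1; rewrite P00 add0r mul1r.
  by rewrite (leq_sizeP _ _ szP).
set k := size ts in IH H *.
have szQ : (size (linprod ts) <= k.+1)%N by exact: size_linprod.
have {}H z : (S k (polar k.+1 z (polar k.+2 (t * x) P)) (linprod ts)).[x] = 0.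
  have := H z; rewrite linprod_cons horner_S_rec // polarC => /eqP.
  by rewrite mulf_eq0 invr_eq0 pnatr_eq0 => /eqP.
have [p0|p0] := eqVneq (polar k.+2 (t * x) P) 0.
  exists (t * x); rewrite (polar_eq0 P0 szP p0) eqxx /= -/k; lia.
have [al lt_al] := IH _ (splits_polar (t * x) sP szP) p0 (size_polar (t * x) szP) H.
exists al; have [al_xi|al_xi] := eqVneq al (t * x).
  have Em := mup_polar_eq P0 szP p0.
  move: lt_al; rewrite al_xi Em /=; lia.
(* The count is at most [k], so [al] is a multiple root of the polar derivative, which must come
   from a root of [P]. *)
have m1 : (1 < mup al (polar k.+2 (t * x) P))%N.
  have := leq_trans lt_al (leq_add (leqnn _) (count_size _ _)).
  by rewrite -/k -[k.+2]add2n leq_add2r.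
by rewrite (mup_multiple_polar sP szP p0 m1 al_xi) addSn ltnS.
Qed.

Lemma size_linprod_pos ts : {in ts, forall t, 0 < t} ->
  size (linprod ts) = (size ts).+1 /\
  (forall i, (i <= size ts)%N -> 0 < (linprod ts)`_i).
Proof.
move=> pos; suff co i : (i <= size ts)%N -> 0 < (linprod ts)`_i.
  split=> //; apply/eqP; rewrite eqn_leq size_linprod ltnNge.
  by apply/negP => /leq_sizeP/(_ _ (leqnn _)) h; have := co _ (leqnn _); rewrite h ltxx.
elim: ts i pos => [|t ts IH] i pos; first by rewrite leqn0 => /eqP ->; rewrite /linprod big_nil coef1.
have {}IH j : (j <= size ts)%N -> 0 < (linprod ts)`_j.
  by apply: IH => u us; apply: pos; rewrite inE us orbT.
have IH0 j : 0 <= (linprod ts)`_j.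
  case: (leqP j (size ts)) => [/IH/ltW//|lt_j].
  by rewrite (leq_sizeP _ _ (size_linprod ts)).
have t0 : 0 < t by apply: pos; rewrite mem_head.
rewrite linprod_cons mulrDl mul1r coefD -scalerAl coefZ coefXM.
case: i => [|i] /=; first by rewrite mulr0 addr0 IH.
by rewrite ltnS => le_i; rewrite ltr_wpDl // mulr_gt0 // IH.
Qed.

(** At a multiple root, [wronskian_gt0] gives G(x) = 0, and then f(x) = 0 gives K(x) = 0. As K + z G
    is the composition with the polar derivative at z, [common_polar_root] applies. *)
Lemma multiple_root_A ts P x : splits P -> P != 0 -> (size P <= (size ts).+1)%N ->
  {in ts, forall t, 0 < t} ->
  let f := S (size ts) P (linprod ts) in
  root f x -> root f^`() x ->
  exists al, (size ts < mup al P + count (fun t => (t * x)%R == al) ts)%N.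
Proof.
case: ts => [|t ts] sP P0 szP pos /= /eqP f0 /eqP f0'.
  move: f0; rewrite S_0_linprod hornerC => P00.
  by move: P0; rewrite (size1_polyC szP) P00 eqxx.
have t0 : 0 < t by apply: pos; rewrite mem_head.
have pos' : {in ts, forall u, 0 <= u}.
  by move=> u us; rewrite ltW // pos // inE us orbT.
have /= := wronskian_gt0 x sP szP t0 pos'.
rewrite f0 f0' !mul0r subrr; set G := (S _ P^`() _).[x] => h.
have c0 : 0 < t / (size ts).+1%:R by rewrite divr_gt0 // ltr0n.
have {h} G0 : G = 0.
  by apply/eqP; rewrite -sqrf_eq0 eq_le sqr_ge0 andbT -(pmulr_rle0 _ c0).
have H z : (S (size ts) (polar (size ts).+1 z P) (linprod ts)).[x] = 0.
  rewrite polarE S_add S_scale hornerD hornerZ -/G G0 mulr0 addr0.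
  move: f0; rewrite linprod_cons S_rec ?size_linprod //.
  rewrite !(hornerZ, hornerD, hornerM, hornerX) -/G G0 !mulr0 addr0 => /eqP.
  by rewrite mulf_eq0 invr_eq0 pnatr_eq0 => /eqP.
have [al lt_al] := common_polar_root sP P0 szP H.
by exists al; apply: leq_trans lt_al _; rewrite leq_add2l leq_addl.
Qed.

Lemma size_exp_lin t j : (size ((1 + t *: 'X) ^+ j : {poly R}) <= j.+1)%N.
Proof.
have := size_linprod (nseq j t); rewrite size_nseq /linprod big_nseq.
by rewrite iter_mulr_1.
Qed.

(** Each factor 1 + t X takes the polar derivative at al, which passes through (X - al)^m and
    multiplies P2(al) by the formal degree of P2. After j steps P2 has become a constant. *)
Lemma horner_S_pow m j al t P2 Q2 x : (size P2 <= j.+1)%N -> (size Q2 <= m.+1)%N ->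
  t * x = al -> exists2 c : R, c != 0 &
  (S (m + j) (('X - al%:P) ^+ m * P2) ((1 + t *: 'X) ^+ j * Q2)).[x] =
  c * P2.[al] * (S m (('X - al%:P) ^+ m) Q2).[x].
Proof.
move=> + szQ tx; elim: j P2 => [|j IH] P2 szP.
  exists 1; first exact: oner_neq0.
  rewrite addn0 expr0 !mul1r (size1_polyC szP) hornerC mulrC mul_polyC.
  by rewrite S_scale hornerZ.
have [|c c0 Ec] := IH (polar j.+1 al P2); first exact: size_polar.
exists ((m + j).+1%:R^-1 * (c * j.+1%:R)).
  by rewrite !mulf_neq0 ?invr_eq0 ?pnatr_eq0.
rewrite addnS exprS -mulrA horner_S_rec.
  rewrite tx polar_XsubCX ?leqW ?leq_addr // -addnS addKn Ec horner_polar.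
  by rewrite subrr mul0r addr0; ring.
rewrite (leq_trans (size_polyMleq _ _)) // -subn1 leq_subLR add1n.
by rewrite (leq_trans (leq_add (size_exp_lin t j) szQ)) // addSn addnS addnC.
Qed.

Lemma XsubC_scale (y : R) : y != 0 -> 'X - y%:P = (- y) *: (1 + (- y^-1) *: 'X).
Proof.
move=> y0; rewrite scalerDr scalerA mulrNN mulfV // scale1r addrC.
by congr (_ + _); rewrite -mul_polyC polyCN mulr1.
Qed.

(** [horner_S_pow] is used twice, the second time with the two polynomials exchanged and the
    exponent 0 in place of m. *)
Lemma horner_S_A m j al be P2 Q2 : al != 0 -> be != 0 ->
  (size P2 <= j.+1)%N -> (size Q2 <= m.+1)%N -> exists2 c : R, c != 0 &
  (S (m + j) (('X - al%:P) ^+ m * P2) (('X - be%:P) ^+ j * Q2)).[- (al * be)] =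
  c * P2.[al] * Q2.[be].
Proof.
move=> al0 be0 szP szQ.
have [|||c c0 Ec] := @horner_S_pow m j al (- be^-1) P2 Q2 (- (al * be)) => //.
  by field.
have [|||d d0 Ed] := @horner_S_pow 0 m be (- al^-1) Q2 1 (- (al * be)) => //.
- by rewrite size_poly1.
- by field.
exists ((- be) ^+ j * (c * ((- al) ^+ m * d))).
  by rewrite !mulf_neq0 ?expf_neq0 ?oppr_eq0.
rewrite (XsubC_scale be0) exprZn -scalerAl S_C S_scale hornerZ S_C Ec.
rewrite (XsubC_scale al0) exprZn S_scale hornerZ S_C -[Q2 in S m Q2]mul1r -[(1 + _) ^+ m]mulr1.
move: Ed; rewrite add0n expr0 => ->.
suff -> : (S 0 1 1).[- (al * be)] = 1 :> R by ring.
have -> : S 0 1 1 = (1 : {poly R}).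
  by apply/polyP => -[|i]; rewrite coef_S !coef1 //= mulr1 divr1.
by rewrite hornerC.
Qed.

Lemma poly_dvd_factor x P j : P != 0 -> (j <= mup x P)%N ->
  exists2 Q, P = ('X - x%:P) ^+ j * Q & root Q x = (j < mup x P)%N.
Proof.
move=> P0 lej; have [Q Qx EP] := mup_factor x P0.
exists (('X - x%:P) ^+ (mup x P - j) * Q).
  by rewrite mulrA -exprD subnKC.
rewrite rootE hornerM mulf_eq0 -[Q.[x] == 0]rootE (negPf Qx) orbF horner_exp expf_eq0.
by rewrite !hornerE subrr eqxx andbT subn_gt0.
Qed.

Lemma size_XsubCX_M (x : R) j Q n : Q != 0 ->
  (size (('X - x%:P) ^+ j * Q)%R <= n.+1)%N = (j + size Q <= n.+1)%N.
Proof.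
by move=> Q0; rewrite size_monicM ?monic_exp ?monicXsubC // size_exp_XsubC.
Qed.

(** Induction on the excess [mu]. Differentiation gives the composition of the derivatives: n drops
    by 1 and the sum of the multiplicities by 2, hence the excess by 1. For excess 0, [horner_S_A]
    gives a non-zero value. *)
Lemma mup_S n mu al be P Q : al != 0 -> be != 0 -> P != 0 -> Q != 0 ->
  (size P <= n.+1)%N -> (size Q <= n.+1)%N -> (mup al P + mup be Q = n + mu)%N ->
  S n P Q != 0 /\ mup (- (al * be)) (S n P Q) = mu.
Proof.
move=> al0 be0; elim: mu n P Q => [|mu IH] n P Q P0 Q0 szP szQ Em.
all: have lP := mup_size al P0 szP; have lQ := mup_size be Q0 szQ.
all: have [P2 EP rP] := poly_dvd_factor P0 (leqnn (mup al P)).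
(* Only n - mup al P linear factors are taken out of [Q]; the cofactor vanishes at [be] exactly when
   the excess is positive. *)
all: have [|Q2 EQ rQ] := @poly_dvd_factor be Q (n - mup al P) Q0; first by lia.
all: have P20 : P2 != 0 by apply: contraNneq P0 => E; rewrite EP E mulr0.
all: have Q20 : Q2 != 0 by apply: contraNneq Q0 => E; rewrite EQ E mulr0.
all: have [||c c0 Ec] := @horner_S_A (mup al P) (n - mup al P) al be P2 Q2 al0 be0.
1,4: by move: szP; rewrite {1}EP size_XsubCX_M // => ?; lia.
1,3: by move: szQ; rewrite {1}EQ size_XsubCX_M // => ?; lia.
all: move: Ec; rewrite -EP -EQ subnKC // => Ec.
  have r0 : ~~ root (S n P Q) (- (al * be)).
    rewrite rootE Ec -mulrA mulf_eq0 (negPf c0) /= mulf_neq0 // -rootE ?rP ?rQ ?ltnn //.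
    lia.
  by split; [apply: contraNneq r0 => ->; rewrite root0 | rewrite mupNroot].
have r0 : root (S n P Q) (- (al * be)).
  by rewrite rootE Ec mulf_eq0 -[Q2.[be] == 0]rootE rQ orbC; apply/orP; left; lia.
have rPa : root P al by rewrite -mup_gt0 //; lia.
have rQb : root Q be by rewrite -mup_gt0 //; lia.
have EP' := mup_deriv P0 rPa; have EQ' := mup_deriv Q0 rQb.
clear EP EQ rP rQ; case: n szP szQ Em lP lQ Ec r0 => [|n] szP szQ Em lP lQ _ r0; first lia.
have dne p x : p != 0 -> root p x -> p^`() != 0 :> {poly R}.
  move=> p0 rx; rewrite -size_poly_eq0 polyorder.size_deriv -lt0n.
  have := root_size_gt1 p0 rx; by case: (size p) => [|[]].
have szd (p : {poly R}) m : (size p <= m.+2)%N -> (size p^`()%R <= m.+1)%N.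
  by rewrite polyorder.size_deriv; case: (size p).
have Em' : (mup al P^`() + mup be Q^`() = n + mu)%N.
  by move: Em; rewrite EP' EQ' !addSn !addnS => -[].
have [f0' Emu] := IH n _ _ (dne _ _ P0 rPa) (dne _ _ Q0 rQb) (szd _ _ szP) (szd _ _ szQ) Em'.
have f0 : S n.+1 P Q != 0.
  by apply: contraNneq f0' => E; have := deriv_S n P Q; rewrite E derivC => /eqP;
     rewrite eq_sym scaler_eq0 invr_eq0 pnatr_eq0.
split=> //; rewrite (mup_deriv f0 r0) deriv_S mupZ ?Emu // invr_eq0 pnatr_eq0 //.
Qed.

Lemma linprod_neq0 ts : linprod ts != 0 :> {poly R}.
Proof.
rewrite /linprod; elim: ts => [|t ts IH]; first by rewrite big_nil oner_neq0.
rewrite big_cons mulf_neq0 //; apply/eqP => /polyP/(_ 0%N).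
by rewrite coefD coef1 coefZ coefX mulr0 addr0 coef0 => /eqP; rewrite oner_eq0.
Qed.

Lemma mup_linprod ts be : mup be (linprod ts) = count (fun t => t * be == - 1) ts.
Proof.
elim: ts => [|t ts IH]; first by rewrite /linprod big_nil mupNroot // root1.
have := linprod_neq0 (t :: ts); rewrite linprod_cons mulf_eq0 negb_or => /andP[t0 l0].
rewrite mupM // IH /=; congr (_ + _)%N.
have rE : root (1 + t *: 'X) be = (t * be == -1).
  by rewrite rootE !hornerE addrC addr_eq0.
case: eqVneq rE => [E|_] rE; last by rewrite mupNroot // rE.
apply/eqP; rewrite eqn_leq -[X in (_ <= X)%N]/1%N mup_gt0 // rE andbT.
apply: mup_size => //; exact: (size_exp_lin t 1).
Qed.

(** For be = - x/al, the factors 1 + t X with t x = al are those that vanish at be. *)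
Lemma mup_S_linprod ts P x al mu : x != 0 -> al != 0 -> P != 0 ->
  (size P <= (size ts).+1)%N ->
  (mup al P + count (fun t => (t * x)%R == al) ts = size ts + mu)%N ->
  S (size ts) P (linprod ts) != 0 /\ mup x (S (size ts) P (linprod ts)) = mu.
Proof.
move=> x0 al0 P0 szP Em.
have -> : x = - (al * (- (x / al))) by field.
apply: mup_S => //; rewrite ?oppr_eq0 ?mulf_neq0 ?invr_eq0 ?linprod_neq0 ?size_linprod //.
rewrite -Em mup_linprod; congr (_ + _)%N; apply: eq_count => t.
by rewrite mulrN eqr_opp mulrA -[_ == 1](inj_eq (mulIf al0)) mul1r divfK.
Qed.

(** [multiple_root_A] provides al with positive excess, and [mup_S_linprod] identifies the excess
    with the multiplicity of x. *)
Lemma mup_multiple_S ts P x : splits P -> P != 0 -> (size P <= (size ts).+1)%N ->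
  {in ts, forall t, 0 < t} -> x != 0 ->
  let f := S (size ts) P (linprod ts) in (1 < mup x f)%N ->
  exists2 al, al != 0 &
    (mup al P + count (fun t => (t * x)%R == al) ts = size ts + mup x f)%N.
Proof.
move=> sP P0 szP pos x0 f m1.
have f0 : f != 0.
  by apply: contraTneq m1 => ->; rewrite /mup; case: arg_maxnP => //= -[[|i] //=]; rewrite size_poly0.
have [rx rx'] := multiple_root_deriv f0 m1.
have [al lt_al] := multiple_root_A sP P0 szP pos rx rx'.
have al0 : al != 0.
  apply: contraTneq lt_al => ->; rewrite -leqNgt (_ : count _ _ = 0)%N.
    by rewrite addn0 mup_size.
  apply/eqP; rewrite -leqn0 leqNgt -has_count; apply/hasPn => t /pos t0.
  by rewrite mulf_eq0 negb_or gt_eqF.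
exists al => //.
have [_ ->] := mup_S_linprod x0 al0 P0 szP (esym (subnKC (ltnW lt_al))).
by rewrite subnKC // ltnW.
Qed.

Lemma mup0_S n P Q : P != 0 -> (size P <= n.+1)%N ->
  (forall i, (i <= n)%N -> Q`_i != 0) ->
  S n P Q != 0 /\ mup 0 (S n P Q) = mup 0 P.
Proof.
move=> P0 szP Q0; have [P2 P2x EP] := mup_factor 0 P0.
have le_mn := mup_size 0 P0 szP.
set m := mup 0 P in EP le_mn *.
have fE i : (S n P Q)`_(i + m) = if (i + m <= n)%N then P2`_i * Q`_(i + m) / 'C(n, i + m)%:R else 0.
  by rewrite coef_S EP polyC0 subr0 coefXnM ltnNge leq_addl /= addnK.
have f_lt i : (i < m)%N -> (S n P Q)`_i = 0.
  by move=> lt_im; rewrite coef_S EP polyC0 subr0 coefXnM lt_im !mul0r if_same.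
have Ef : S n P Q = ('X - 0%:P) ^+ m * drop_poly m (S n P Q).
  rewrite -{1}[S n P Q](poly_take_drop m) polyC0 subr0 mulrC -[RHS]add0r; congr (_ + _).
  by apply/polyP => i; rewrite coef_take_poly coef0; case: ltnP => // /f_lt.
have r0 : ~~ root (drop_poly m (S n P Q)) 0.
  rewrite rootE horner_coef0 coef_drop_poly fE add0n le_mn.
  rewrite !mulf_neq0 ?Q0 // ?invr_eq0 ?pnatr_eq0 -?lt0n ?bin_gt0 //.
  by rewrite -horner_coef0.
split; last by rewrite Ef mup_XsubCM.
rewrite Ef mulf_neq0 ?expf_neq0 ?polyXsubC_eq0 //.
by apply: contraNneq r0 => ->; rewrite root0.
Qed.

End ARoots.

(** * Interlacing *)

Section Interlacing.
Variable R : realType.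
Implicit Types (f G P Q : {poly R}) (s r ts : seq R) (n : nat) (p : pred R).

(** Initial segments of the line. Interlacing is expressed by counting roots in them, which also
    covers common and multiple roots. *)
Definition down p := forall x y : R, x < y -> p y -> p x.

Lemma ivt_chain f g s : path <%R g s -> path (fun a b => f.[a] * f.[b] < 0) g s ->
  exists r, [/\ size r = size s, path <%R g r, all (root f) r &
    forall p, down p -> (count p s <= count p r <= count p (belast g s))%N].
Proof.
elim: s g => [|h s IH] g /=; first by exists [::].
case/andP => lt_gh ps /andP[fgh pf].
have [x] := poly_ivtoo (ltW lt_gh) fgh; rewrite in_itv /= => /andP[gx xh] rx.
have [r [szr pr rr cr]] := IH h ps pf; exists (x :: r); split=> /=.
- by rewrite szr.
- rewrite gx /=; case: (r) pr => //= y r' /andP[hy ->].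
  by rewrite (lt_trans xh hy).
- by rewrite rx.
move=> p dp; have /andP[c1 c2] := cr p dp; apply/andP; split; apply: leq_add => //.
  by case ph: (p h) => //; rewrite (dp _ _ xh ph).
by case px: (p x) => //; rewrite (dp _ _ gx px).
Qed.

(** The derivative of a product with simple roots alternates in sign along them and is positive at
    the last one. So [f], of opposite sign there, alternates too, and f(M) > 0 continues the
    pattern. *)
Lemma alternate f s M : sorted <%R s -> {in s, forall x, x < M} -> 0 < f.[M] ->
  {in s, forall x, f.[x] * (\prod_(a <- s) ('X - a%:P))^`().[x] < 0} ->
  sorted (fun a b => f.[a] * f.[b] < 0) (rcons s M) /\
  0 < (-1) ^+ size s * f.[head M s].
Proof.
move=> + + fM; elim: s => [|g s IH] //= ps sM cond; first by rewrite mul1r.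
have gs : {in s, forall x, g < x} by apply/allP; rewrite (order_path_min lt_trans ps).
have d x : ((\prod_(a <- g :: s) ('X - a%:P))^`()).[x] =
   (\prod_(a <- s) ('X - a%:P)).[x] + (x - g) * (\prod_(a <- s) ('X - a%:P))^`().[x].
  by rewrite big_cons derivM derivXsubC mul1r !(hornerD, hornerM, hornerX, hornerN, hornerC).
have [|||so sg] := IH.
- exact: path_sorted ps.
- by move=> x xs; apply: sM; rewrite inE xs orbT.
- move=> x xs; have := cond x; rewrite inE xs orbT d => /(_ isT).
  have /eqP -> : (\prod_(a <- s) ('X - a%:P)).[x] == 0 by rewrite -rootE root_prod_XsubC.
  by rewrite add0r mulrCA pmulr_rlt0 // subr_gt0 gs.
have sgn : 0 < (-1) ^+ size s * (\prod_(a <- s) ('X - a%:P)).[g].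
  elim: (s) gs => [|a s' IHs] gs; first by rewrite big_nil hornerC mulr1.
  rewrite big_cons /= exprS hornerM hornerXsubC mulrACA mulr_gt0 //.
    by have := gs a (mem_head _ _); lra.
  by apply: IHs => x xs; apply: gs; rewrite inE xs orbT.
have fg : 0 < (-1) ^+ (size s).+1 * f.[g].
  have := cond g (mem_head _ _); rewrite d subrr mul0r addr0 => h.
  rewrite -(pmulr_lgt0 _ sgn) exprS mulN1r !mulNr mulrACA -expr2 sqrr_sign mul1r.
  by rewrite oppr_gt0.
split=> //; have : f.[g] * f.[head M s] < 0.
  have := mulr_gt0 fg sg; rewrite exprS mulN1r !mulNr mulrACA -expr2 sqrr_sign mul1r.
  by rewrite oppr_gt0.
by case: (s) so => /= [_ ->|a s' -> ->].
Qed.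

Lemma exists_bound s (b : R) : exists2 M, b <= M & {in s, forall x, - M < x < M}.
Proof.
elim: s => [|x s [M bM IH]]; first by exists b.
exists (Num.max M (`|x| + 1)); first by rewrite le_max bM.
have [h1 h2] : M <= Num.max M (`|x| + 1) /\ `|x| + 1 <= Num.max M (`|x| + 1).
  by rewrite !le_max !lexx orbT.
move=> y; rewrite inE => /predU1P[->|/IH /andP[]]; last by move=> *; apply/andP; split; lra.
by rewrite -ltr_norml; lra.
Qed.

(** Beyond a Cauchy bound M the sign of f is that of its leading term, so f alternates along - M,
    the points of s, and M. This yields size s + 1 roots, as many as the degree of f. *)
Lemma interlacing_simple f s : f \is monic -> size f = (size s).+2 ->
  {in s, forall x, f.[x] * (\prod_(a <- s) ('X - a%:P))^`().[x] < 0} -> uniq s ->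
  exists r, f = \prod_(a <- r) ('X - a%:P) /\
    forall p, down p -> (count p s <= count p r <= (count p s).+1)%N.
Proof.
move=> mf szf cond us.
wlog ss : s szf cond us / sorted <%R s.
  move=> H; have pe : perm_eq (sort <=%R s) s by rewrite perm_sort.
  have [||||r [Er cr]] := H (sort <=%R s).
  - by rewrite size_sort.
  - by move=> x; rewrite mem_sort (perm_big _ pe); exact: cond.
  - by rewrite sort_uniq.
  - by rewrite sort_lt_sorted.
  by exists r; split=> // p dp; rewrite -(permP pe) // cr.
have f0 : f != 0 by exact: monic_neq0.
have [M bM sM] := exists_bound s (cauchy_bound f).
have M0 : 0 < M by apply: lt_le_trans bM; exact: cauchy_bound_gt0.
have fM : 0 < f.[M].
  rewrite -sgr_gt0 (@sgp_pinftyP _ M) ?in_itv /= ?lexx //.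
    by rewrite /sgp_pinfty (monicP mf) sgr1 ltr01.
  move=> y; rewrite in_itv /= andbT => My; apply: (ge_cauchy_bound f0).
  by rewrite in_itv /= andbT (le_trans bM).
have fN : 0 < (-1) ^+ (size s).+1 * f.[- M].
  have -> : (-1) ^+ (size s).+1 * f.[- M] = `|f.[- M]|.
    rewrite [in RHS]normrEsg (@sgp_minftyP _ (- M)) ?in_itv /= ?lexx //.
      by rewrite /sgp_minfty (monicP mf) mulr1 szf /= sgrX sgrN1.
    move=> y; rewrite in_itv /= => My; apply: (le_cauchy_bound f0).
    by rewrite in_itv /= (le_trans My) // lerN2.
  rewrite normr_gt0 -rootE; apply: (le_cauchy_bound f0).
  by rewrite in_itv /= lerN2.
have sM' : {in s, forall x, x < M} by move=> x /sM /andP[].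
have [so sh] := alternate ss sM' fM cond.
have pM : path <%R (- M) (rcons s M).
  rewrite rcons_path; apply/andP; split.
    by rewrite path_min_sorted //; apply/allP => x /sM /andP[].
  by case/lastP: (s) sM' => [|s' y] h /=; [lra | rewrite last_rcons h // mem_rcons mem_head].
have pf : path (fun a b => f.[a] * f.[b] < 0) (- M) (rcons s M).
  have : f.[- M] * f.[head M s] < 0.
    have := mulr_gt0 fN sh; rewrite exprS mulN1r !mulNr mulrACA -expr2 sqrr_sign mul1r.
    by rewrite oppr_gt0.
  by case: (s) so => /= [_ ->|a s' -> ->].
have [r [szr pr rr cr]] := ivt_chain pM pf; exists r; split.
  rewrite [LHS](@all_roots_prod_XsubC _ f r) // ?(monicP mf) ?scale1r //.
    by rewrite szf szr size_rcons.
  rewrite uniq_rootsE; apply: lt_sorted_uniq; exact: path_sorted pr.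
move=> p dp; have /andP[c1 c2] := cr p dp; apply/andP; split.
  by apply: leq_trans c1; rewrite -cats1 count_cat leq_addr.
by apply: leq_trans c2 _; rewrite belast_rcons /=; case: (p _).
Qed.

(** By continuity. It allows the Wronskian inequality to be divided by (y - x)^2 at y = x as
    well. *)
Lemma ge0_punctured f x : (forall y, y != x -> 0 <= f.[y]) -> 0 <= f.[x].
Proof.
move=> H; rewrite leNgt; apply/negP => fx.
have [d d0 Hd] := poly_cont x f (e := - f.[x]) (ltac:(by rewrite oppr_gt0)).
have y0 : x + d / 2%:R != x.
  by rewrite -subr_eq0 addrAC subrr add0r mulf_neq0 ?invr_eq0 ?gt_eqF ?ltr0n.
have yd : `|x + d / 2%:R - x| < d.
  by rewrite addrAC subrr add0r ger0_norm; lra.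
have := Hd _ yd; have := H _ y0; rewrite ltr_norml => h /andP[_]; lra.
Qed.

(** Removing a common root x from f and G divides the Wronskian by (X - x)^2. Without common roots,
    the bound on multiplicities makes the roots of G simple, and the Wronskian inequality gives f G'
    < 0 there. *)
Lemma interlacing_monic f s : f \is monic -> size f = (size s).+2 ->
  let G := \prod_(a <- s) ('X - a%:P) in
  (forall x, 0 <= f^`().[x] * G.[x] - f.[x] * G^`().[x]) ->
  (forall x, mup x G <= (mup x f).+1)%N ->
  exists r, f = \prod_(a <- r) ('X - a%:P) /\
    forall p, down p -> (count p s <= count p r <= (count p s).+1)%N.
Proof.
elim: {s}(size s) {-2}s (erefl (size s)) f => [|n IH] s szs f mf szf G W mu.
  case: s szs szf {W mu} @G => // _ szf G; exact: interlacing_simple.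
have G0 : G != 0 by rewrite monic_neq0 ?monic_prod_XsubC.
have f0 : f != 0 by exact: monic_neq0.
have [/hasP[x xs rx]|/hasPn nr] := boolP (has (root f) s).
  have := perm_to_rem xs; set s2 := rem x s => pe.
  have EG : G = ('X - x%:P) * \prod_(a <- s2) ('X - a%:P).
    by rewrite /G (perm_big _ pe) big_cons.
  move: rx; rewrite -dvdp_XsubCl => /dvdpP[f2 Ef]; rewrite mulrC in Ef.
  have f20 : f2 != 0 by apply: contraNneq f0 => E; rewrite Ef E mulr0.
  have mf2 : f2 \is monic by move: mf; rewrite Ef monicMl ?monicXsubC.
  have sz2 : size s2 = n by rewrite size_rem // szs.
  have G20 : \prod_(a <- s2) ('X - a%:P) != 0 :> {poly R} by rewrite monic_neq0 ?monic_prod_XsubC.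
  have [|||r [Er cr]] := IH s2 sz2 f2 mf2.
  - move: szf; rewrite Ef size_monicM ?monicXsubC // size_XsubC szs sz2.
    by rewrite add2n => -[].
  - have W2 y : f^`().[y] * G.[y] - f.[y] * G^`().[y] = (y - x) ^+ 2 *
     (f2^`().[y] * (\prod_(a <- s2) ('X - a%:P)).[y] - f2.[y] * (\prod_(a <- s2) ('X - a%:P))^`().[y]).
      by rewrite EG Ef !derivE !(hornerD, hornerM, hornerX, hornerN, hornerC); ring.
    move=> y; pose w := f2^`() * (\prod_(a <- s2) ('X - a%:P)) - f2 * (\prod_(a <- s2) ('X - a%:P))^`().
    have wE z : w.[z] = f2^`().[z] * (\prod_(a <- s2) ('X - a%:P)).[z] - f2.[z] * (\prod_(a <- s2) ('X - a%:P))^`().[z].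
      by rewrite !(hornerD, hornerM, hornerN).
    rewrite -wE; have Hw z : z != x -> 0 <= w.[z].
      move=> zx; have := W z; rewrite W2 pmulr_rge0 ?wE //.
      by rewrite exprn_even_gt0 //= subr_eq0.
    by have [->|/Hw//] := eqVneq y x; apply: ge0_punctured.
  - move=> y; have := mu y; rewrite EG Ef !mupM ?polyXsubC_eq0 //.
    by rewrite -addnS leq_add2l.
  exists (x :: r); split; first by rewrite big_cons -Er.
  by move=> p /cr; rewrite (permP pe) /= -addnS !leq_add2l.
apply: interlacing_simple => //.
  move=> x xs; have fx : f.[x] != 0 by exact: nr.
  have Gx : G.[x] = 0 by apply/eqP; rewrite -rootE root_prod_XsubC.
  have := W x; rewrite Gx mulr0 sub0r oppr_ge0 => h.
  rewrite lt_neqAle h mulf_neq0 //.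
  have rG : root G x by rewrite root_prod_XsubC.
  have := mu x; rewrite (mupNroot (nr x xs)) (mup_deriv G0 rG) ltnS leqn0 => E.
  apply/negP => rG'; move: E; rewrite eqn0Ngt mup_gt0 ?rootE ?rG' //.
  by rewrite -size_poly_eq0 polyorder.size_deriv size_prod_XsubC szs.
apply: count_mem_uniq => x; rewrite -mu_prod_XsubC -/G.
have [xs|xs] := boolP (x \in s); last by rewrite mupNroot // root_prod_XsubC.
apply/eqP; rewrite eqn_leq mup_gt0 // root_prod_XsubC xs andbT.
by rewrite (leq_trans (mu x)) // (mupNroot (nr x xs)).
Qed.

End Interlacing.

(** * Counting the roots on either side of a point *)

Lemma sum_count_mem (T : eqType) (p : pred T) (r s : seq T) :
  uniq r -> {subset s <= r} -> (\sum_(x <- r | p x) count_mem x s = count p s)%N.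
Proof.
move=> ur; elim: s => [|y s IH] sr; first by rewrite big1.
rewrite /= big_split /= IH => [|z zs]; last by apply: sr; rewrite inE zs orbT.
congr (_ + _)%N; rewrite big_mkcond (bigD1_seq y) ?sr ?mem_head //= eqxx big1 ?addn0.
  by case: (p y).
by move=> z zy; rewrite eq_sym (negPf zy) if_same.
Qed.

Section Counting.
Variable R : realType.
Implicit Types (f G P Q : {poly R}) (s r ts : seq R) (n : nat) (p : pred R).
Local Notation S := (@schur_szego R).

Lemma mem_rootsR P x : P != 0 -> (x \in rootsR P) = root P x.
Proof. by move=> P0; have := roots_on_rootsR P0 x; rewrite in_itv. Qed.

Lemma uniq_rootsR P : uniq (rootsR P).
Proof. exact: uniq_roots. Qed.

Lemma sum_mup_rootsR k s p : k != 0 -> let P := k *: \prod_(a <- s) ('X - a%:P) in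
  (\sum_(x <- rootsR P | p x) mup x P = count p s)%N.
Proof.
move=> k0 P; have P0 : P != 0.
  by rewrite scaler_eq0 (negPf k0) monic_neq0 ?monic_prod_XsubC.
rewrite -(sum_count_mem p (uniq_rootsR P) (s := s)).
  by apply: eq_bigr => x _; rewrite mupZ // mu_prod_XsubC.
by move=> x xs; rewrite mem_rootsR // rootZ // root_prod_XsubC.
Qed.

Lemma nb_leftE k s c : k != 0 ->
  nb_left (k *: \prod_(a <- s) ('X - a%:P)) c = count (fun x => x < c) s.
Proof. exact: sum_mup_rootsR. Qed.

Lemma nb_rightE k s c : k != 0 ->
  nb_right (k *: \prod_(a <- s) ('X - a%:P)) c = count (fun x => c < x) s.
Proof. exact: sum_mup_rootsR. Qed.

Lemma count_tricho s c :
  (count (fun x => x < c)%R s + count_mem c s + count (fun x => c < x)%R s = size s)%N.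
Proof. by elim: s => //= x s <-; case: ltgtP => _ /=; lia. Qed.

Lemma nb_total P c : splits P -> P != 0 ->
  (nb_left P c + mup c P + nb_right P c).+1%N = size P.
Proof.
move=> [s EP]; rewrite -lead_coef_eq0 => k0; rewrite EP nb_leftE // nb_rightE // mupZ //.
by rewrite mu_prod_XsubC size_scale // size_prod_XsubC count_tricho.
Qed.

(** Weak interlacing in counting form, with multiplicities. The lists of roots also record that both
    polynomials are real-rooted. *)
Definition interlaces f G := exists rf rG,
  [/\ f = lead_coef f *: \prod_(a <- rf) ('X - a%:P),
      G = lead_coef G *: \prod_(a <- rG) ('X - a%:P),
      size rf = (size rG).+1 &
      forall p, down p -> (count p rG <= count p rf <= (count p rG).+1)%N].

Lemma interlacing f G : G != 0 -> splits G -> size f = (size G).+1 ->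
  0 < lead_coef f * lead_coef G ->
  (forall x, 0 <= f^`().[x] * G.[x] - f.[x] * G^`().[x]) ->
  (forall x, mup x G <= (mup x f).+1)%N -> interlaces f G.
Proof.
move=> G0 [s EG] szf lc W mu.
have k0 : lead_coef f != 0 by apply: contraTneq lc => ->; rewrite mul0r ltxx.
have l0 : lead_coef G != 0 by rewrite lead_coef_eq0.
have szG : size G = (size s).+1 by rewrite EG size_scale // size_prod_XsubC.
pose f1 := (lead_coef f)^-1 *: f.
have Ef : f = lead_coef f *: f1 by rewrite scalerA mulfV // scale1r.
have [||||r [Er cr]] := @interlacing_monic R f1 s.
- by rewrite monicE lead_coefZ mulVf.
- by rewrite size_scale ?invr_eq0 // szf szG.
- move=> x; have := W x.
  have -> : f.[x] = lead_coef f * f1.[x] by rewrite {1}Ef hornerZ.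
  have -> : G.[x] = lead_coef G * (\prod_(a <- s) ('X - a%:P)).[x] by rewrite {1}EG hornerZ.
  have -> : f^`().[x] = lead_coef f * f1^`().[x] by rewrite {1}Ef derivZ hornerZ.
  have -> : G^`().[x] = lead_coef G * (\prod_(a <- s) ('X - a%:P))^`().[x].
    by rewrite {1}EG derivZ hornerZ.
  rewrite mulrACA [X in _ - X]mulrACA -mulrBr pmulr_rge0 //.
- by move=> x; rewrite -(mupZ x _ l0) -EG [mup x f1]mupZ ?invr_eq0.
exists r, s; split=> //; first by rewrite -Er.
apply/eqP; rewrite -eqSS -(size_prod_XsubC r id) -Er size_scale ?invr_eq0 // szf szG //.
Qed.

Lemma interlaces_splits f G : interlaces f G -> splits f.
Proof. by case=> rf [rG [Ef _ _ _]]; exists rf. Qed.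

Lemma interlaces_nb f G c : interlaces f G -> f != 0 -> G != 0 ->
  (nb_left G c <= nb_left f c <= (nb_left G c).+1)%N &&
  (nb_right G c <= nb_right f c <= (nb_right G c).+1)%N.
Proof.
move=> [rf [rG [Ef EG sz cp]]]; rewrite -!lead_coef_eq0 => k0 l0.
rewrite Ef EG !nb_leftE // !nb_rightE //.
rewrite cp /=; last by move=> x y; exact: lt_trans.
have ge s : (count (fun x => x <= c)%R s + count (fun x => c < x)%R s = size s)%N.
  by rewrite -(count_predC (fun x => x <= c)); congr (_ + _)%N; apply: eq_count => x /=; rewrite ltNge.
have dle : down (fun x => x <= c) by move=> x y xy yc; exact: le_trans (ltW xy) yc.
move: (cp _ dle) (ge rf) (ge rG); rewrite sz.
set a := count _ rG; set b := count _ rf; set d := count _ rf; set e := count _ rG.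
clear -R; move: (size rG) => m; move: a b d e => a b d e; lia.
Qed.

(** The multiplicity takes up the whole growth of the degree, and neither side count can drop. *)
Lemma interlaces_mupS f G c : interlaces f G -> f != 0 -> G != 0 -> size f = (size G).+1 ->
  splits G -> mup c f = (mup c G).+1 ->
  nb_left f c = nb_left G c /\ nb_right f c = nb_right G c.
Proof.
move=> fG f0 G0 sz sG Em; have := interlaces_nb c fG f0 G0.
by have := nb_total c (interlaces_splits fG) f0; have := nb_total c sG G0; lia.
Qed.

(** The two side counts together grow by two, and each by at most one. *)
Lemma interlaces_Smup f G c : interlaces f G -> f != 0 -> G != 0 -> size f = (size G).+1 ->
  splits G -> mup c G = (mup c f).+1 ->
  nb_left f c = (nb_left G c).+1 /\ nb_right f c = (nb_right G c).+1.
Proof.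
move=> fG f0 G0 sz sG Em; have := interlaces_nb c fG f0 G0.
by have := nb_total c (interlaces_splits fG) f0; have := nb_total c sG G0; lia.
Qed.

Lemma prod_XsubC_mup s c : \prod_(a <- s) ('X - a%:P) =
  ('X - c%:P) ^+ count_mem c s * \prod_(a <- s | a != c) ('X - a%:P).
Proof.
elim: s => [|a s IH]; first by rewrite !big_nil expr0 mulr1.
rewrite !big_cons IH /=; case: eqVneq => [->|_] /=; first by rewrite exprS mulrA.
by rewrite mulrCA.
Qed.

Lemma sign_cofactor f m f2 c : splits f -> ~~ root f2 c -> f = ('X - c%:P) ^+ m * f2 ->
  0 < (-1) ^+ nb_right f c * (lead_coef f * f2.[c]).
Proof.
move=> [s Ef] r2 Ef2; have f20 : f2 != 0 by apply: contraNneq r2 => ->; rewrite root0.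
have k0 : lead_coef f != 0.
  by rewrite lead_coef_eq0 Ef2 mulf_neq0 ?expf_neq0 ?polyXsubC_eq0.
have Em : m = count_mem c s.
  by rewrite -mu_prod_XsubC -(mupZ _ _ k0) -Ef Ef2 mup_XsubCM.
have -> : f2 = lead_coef f *: \prod_(a <- s | a != c) ('X - a%:P).
  apply: (@mulfI _ (('X - c%:P) ^+ m)); first by rewrite expf_neq0 ?polyXsubC_eq0.
  by rewrite -Ef2 {1}Ef (prod_XsubC_mup s c) Em scalerAr.
have -> : nb_right f c = count (fun x => c < x) s by rewrite Ef nb_rightE.
rewrite hornerZ mulrA -expr2 mulrCA pmulr_rgt0 ?exprn_even_gt0 //.
elim: s {Ef Em} => [|a s IH] /=; first by rewrite big_nil hornerC mulr1.
rewrite big_cons; case: (ltgtP c a) => [ca|ac|<-] //=.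
  by rewrite add1n exprS hornerM hornerXsubC mulrACA mulr_gt0 // mulN1r; lra.
by rewrite add0n hornerM hornerXsubC mulrCA mulr_gt0 // subr_gt0.
Qed.

(** With equal multiplicities exactly one side gains a root. By [sign_cofactor], the sign of f2(c)
    G2(c) gives the parity of the change on the right. *)
Lemma interlaces_sign f G m f2 G2 c : interlaces f G -> size f = (size G).+1 ->
  splits G -> 0 < lead_coef f * lead_coef G -> ~~ root f2 c -> ~~ root G2 c ->
  f = ('X - c%:P) ^+ m * f2 -> G = ('X - c%:P) ^+ m * G2 ->
  if 0 < f2.[c] * G2.[c]
  then nb_left f c = (nb_left G c).+1 /\ nb_right f c = nb_right G c
  else nb_left f c = nb_left G c /\ nb_right f c = (nb_right G c).+1.
Proof.
move=> fG sz sG lc rf rG Ef EG.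
have f0 : f != 0 by apply: contraTneq lc => ->; rewrite lead_coef0 mul0r ltxx.
have G0 : G != 0 by apply: contraTneq lc => ->; rewrite lead_coef0 mulr0 ltxx.
have sf := interlaces_splits fG.
have mf : mup c f = m by rewrite Ef mup_XsubCM.
have mG : mup c G = m by rewrite EG mup_XsubCM.
have := nb_total c sf f0; have := nb_total c sG G0; have := interlaces_nb c fG f0 G0.
have := mulr_gt0 (sign_cofactor sf rf Ef) (sign_cofactor sG rG EG).
rewrite mulrACA -exprD (mulrACA (lead_coef f)) [X in 0 < X]mulrCA pmulr_rgt0 //.
rewrite -signr_odd oddD mf mG sz; case: ifP => h sg.
  have : odd (nb_right f c) = odd (nb_right G c).
    by move: sg; case: odd; case: odd => //=; rewrite expr1 mulN1r oppr_gt0 ltNge ltW.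
  by split; lia.
have : odd (nb_right f c) = ~~ odd (nb_right G c).
  by move: sg; case: odd; case: odd => //=; rewrite expr0 mul1r h.
by split; lia.
Qed.

End Counting.

(** * Real-rootedness and position of the roots of the composition *)

Section Composition.
Variable R : realType.
Implicit Types (f G P Q : {poly R}) (s r ts : seq R) (n : nat) (p : pred R).
Local Notation S := (@schur_szego R).

Lemma lead_S n P Q : size P = n.+1 -> size Q = n.+1 ->
  size (S n P Q) = n.+1 /\ lead_coef (S n P Q) = lead_coef P * lead_coef Q.
Proof.
move=> sP sQ; have E : (S n P Q)`_n = lead_coef P * lead_coef Q.
  by rewrite coef_S leqnn binn divr1 !lead_coefE sP sQ.
have nz (q : {poly R}) : size q = n.+1 -> lead_coef q != 0.
  by move=> sq; rewrite lead_coef_eq0 -size_poly_eq0 sq.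
have sz : size (S n P Q) = n.+1.
  apply/eqP; rewrite eqn_leq size_S ltnNge; apply/negP => /leq_sizeP/(_ _ (leqnn n)).
  by rewrite E => /eqP; rewrite mulf_eq0 (negPf (nz P sP)) (negPf (nz Q sQ)).
by split=> //; rewrite lead_coefE sz.
Qed.

Lemma size_deriv_eq P n : size P = n.+2 -> size P^`() = n.+1 /\ P^`() != 0.
Proof.
by move=> sz; rewrite -size_poly_eq0 polyorder.size_deriv sz.
Qed.

Lemma lead_coef_deriv P n : size P = n.+2 -> lead_coef P^`() = n.+1%:R * lead_coef P.
Proof.
move=> sz; have [sz' _] := size_deriv_eq sz.
by rewrite !lead_coefE sz sz' /= coef_deriv mulr_natl.
Qed.

(** Only multiple roots x of the composition with P' need an argument. For x <> 0, such a root comes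
    from a multiple root al of P', whose multiplicity in P is one more; so the excess stays the
    same, or grows by one if t x = al. At x = 0 the multiplicities are those of P and P'. *)
Lemma mup_S_deriv t ts P x : splits P -> size P = (size ts).+2 ->
  {in t :: ts, forall t, 0 < t} ->
  (mup x (S (size ts) P^`() (linprod ts)) <=
    (mup x (S (size ts).+1 P (linprod (t :: ts)))).+1)%N.
Proof.
move=> sP szP pos; have [szP' P'0] := size_deriv_eq szP.
have P0 : P != 0 by rewrite -size_poly_eq0 szP.
have pos' : {in ts, forall t, 0 < t} by move=> u us; apply: pos; rewrite inE us orbT.
have [->|x0] := eqVneq x 0.
  have [_ c1] := size_linprod_pos pos; have [_ c2] := size_linprod_pos pos'.
  have [||_ ->] := @mup0_S R (size ts).+1 P (linprod (t :: ts)) P0.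
  - by rewrite szP.
  - by move=> i li; rewrite gt_eqF // c1.
  have [||_ ->] := @mup0_S R (size ts) P^`() (linprod ts) P'0.
  - by rewrite szP'.
  - by move=> i li; rewrite gt_eqF // c2.
  have [m1|] := ltnP 1 (mup 0 P^`()); last by move/leq_trans; apply.
  by rewrite (mup_multiple_deriv sP P'0 m1) leqW.
have [m1|] := ltnP 1 (mup x (S (size ts) P^`() (linprod ts))); last by move/leq_trans; apply.
have [|al al0 Em] := mup_multiple_S (splits_deriv sP) P'0 _ pos' x0 m1; first by rewrite szP'.
have cle := count_size (fun t => t * x == al) ts.
have m'1 : (1 < mup al P^`())%N.
  have aux (a b c d : nat) : (a + b = d + c -> 1 < c -> b <= d -> 1 < a)%N by lia.
  exact: aux Em m1 cle.
have Em2 := mup_multiple_deriv sP P'0 m'1.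
have [||_ ->] := @mup_S_linprod R (t :: ts) P x al
   ((t * x == al) + mup x (S (size ts) P^`() (linprod ts))) x0 al0 P0.
- by rewrite szP.
- by rewrite Em2 /= addSn addnCA Em addnCA.
by rewrite leqW // leq_addl.
Qed.

(** The hypothesis [splits G] is discharged by induction on [ts] in [splits_S]. *)
Lemma S_interlaces_step t ts P : splits P -> size P = (size ts).+2 ->
  {in t :: ts, forall t, 0 < t} ->
  let f := S (size ts).+1 P (linprod (t :: ts)) in
  let G := S (size ts) P^`() (linprod ts) in
  splits G ->
  [/\ interlaces f G, splits G, size f = (size ts).+2, size G = (size ts).+1 &
      0 < lead_coef f * lead_coef G].
Proof.
move=> sP szP pos f G sG; have [szP' P'0] := size_deriv_eq szP.
have pos' : {in ts, forall t, 0 < t} by move=> u us; apply: pos; rewrite inE us orbT.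
have sL := (size_linprod_pos pos).1; have sL' := (size_linprod_pos pos').1.
have lin_gt0 us : {in us, forall t, 0 < t} -> 0 < lead_coef (linprod us) :> R.
  by move=> pu; have [sz co] := size_linprod_pos pu; rewrite lead_coefE sz /= co.
have [szf lcf] := lead_S szP sL; have [szG lcG] := lead_S szP' sL'.
have lc : 0 < lead_coef f * lead_coef G.
  rewrite lcf lcG (lead_coef_deriv szP) [X in 0 < X](_ : _ = lead_coef P ^+ 2 *
    ((size ts).+1%:R * (lead_coef (linprod (t :: ts)) * lead_coef (linprod ts)))); last by ring.
  apply: mulr_gt0; last by rewrite !mulr_gt0 ?lin_gt0 ?ltr0n.
  by rewrite exprn_even_gt0 //= lead_coef_eq0 -size_poly_eq0 szP.
split=> //; apply: interlacing => //.
- by rewrite -size_poly_eq0 szG.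
- by rewrite szf szG.
- move=> x; have t0 : 0 < t by apply: pos; rewrite mem_head.
  have := wronskian_gt0 x sP _ t0 (fun v vs => ltW (pos' v vs)).
  rewrite szP => /(_ (leqnn _)); apply: le_trans.
  by rewrite mulr_ge0 ?sqr_ge0 // divr_ge0 // ltW.
by move=> x; apply: mup_S_deriv.
Qed.

Lemma splits_const P : (size P <= 1)%N -> splits P.
Proof.
move=> szP; exists [::]; rewrite big_nil {1}(size1_polyC szP) alg_polyC.
by rewrite {2}(size1_polyC szP) lead_coefC.
Qed.

Lemma splits_S ts P : splits P -> size P = (size ts).+1 -> {in ts, forall t, 0 < t} ->
  splits (S (size ts) P (linprod ts)).
Proof.
elim: ts P => [|t ts IH] P sP szP pos; first by apply: splits_const; exact: size_S.
have pos' : {in ts, forall t, 0 < t} by move=> u us; apply: pos; rewrite inE us orbT.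
have sG := IH _ (splits_deriv sP) (size_deriv_eq szP).1 pos'.
by have [/interlaces_splits] := S_interlaces_step sP szP pos sG.
Qed.

Lemma S_interlaces t ts P : splits P -> size P = (size ts).+2 ->
  {in t :: ts, forall t, 0 < t} ->
  let f := S (size ts).+1 P (linprod (t :: ts)) in
  let G := S (size ts) P^`() (linprod ts) in
  [/\ interlaces f G, splits G, size f = (size ts).+2, size G = (size ts).+1 &
      0 < lead_coef f * lead_coef G].
Proof.
move=> sP szP pos; apply: S_interlaces_step => //.
apply: splits_S => [||u us]; rewrite ?(size_deriv_eq szP).1 //; first exact: splits_deriv.
by apply: pos; rewrite inE us orbT.
Qed.

Lemma coef_linprod_nseq n t i : (i <= n)%N ->
  (linprod (nseq n t))`_i = 'C(n, i)%:R * t ^+ i :> R.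
Proof.
elim: n i => [|n IH] i; first by rewrite leqn0 => /eqP ->; rewrite /linprod big_nil coef1 mulr1.
rewrite linprod_cons mulrDl mul1r coefD -scalerAl coefZ coefXM.
case: i => [|i] /=; first by rewrite mulr0 addr0 IH // !bin0.
rewrite ltnS => le_in; rewrite (IH i) // binS natrD exprS.
move: le_in; rewrite leq_eqVlt => /predU1P[->|lt_in].
  have L0 : (linprod (nseq n t))`_n.+1 = 0 :> R.
    by have := size_linprod (nseq n t); rewrite size_nseq => /leq_sizeP ->.
  by rewrite L0 (bin_small (ltnSn n)) mulr0n !add0r mulrCA.
rewrite IH // exprS; ring.
Qed.

Lemma coef_S_nseq n t P i : (size P <= n.+1)%N ->
  (S n P (linprod (nseq n t)))`_i = P`_i * t ^+ i.
Proof.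
move=> szP; rewrite coef_S; case: leqP => le_in; last by rewrite (leq_sizeP _ _ szP) // mul0r.
rewrite coef_linprod_nseq //; field.
by rewrite pnatr_eq0 -lt0n bin_gt0.
Qed.

Lemma S_ones n P : (size P <= n.+1)%N -> S n P (linprod (nseq n 1)) = P.
Proof. by move=> szP; apply/polyP => i; rewrite coef_S_nseq // expr1n mulr1. Qed.

(** As (1 + X)^n is neutral for the composition, P and P' are the pair f, G in which every t is
    1. *)
Lemma deriv_interlaces P n : splits P -> size P = n.+2 ->
  interlaces P P^`() /\ 0 < lead_coef P * lead_coef P^`().
Proof.
move=> sP szP; have pos : {in 1 :: nseq n 1, forall t : R, 0 < t}.
  by move=> t; rewrite inE mem_nseq => /orP[/eqP ->|/andP[_ /eqP ->]]; rewrite ltr01.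
have [szP' _] := size_deriv_eq szP.
have := @S_interlaces 1 (nseq n 1) P sP; rewrite size_nseq => /(_ szP pos) [].
by rewrite -[_ :: nseq n 1]/(nseq n.+1 1) !S_ones ?szP ?szP'.
Qed.

(** Composition with (1 + t X)^n is the substitution of t X for X. *)
Lemma S_scaling n t P : t != 0 -> splits P -> P != 0 -> (size P <= n.+1)%N ->
  exists s, [/\ P = lead_coef P *: \prod_(a <- s) ('X - a%:P) &
   exists2 k, k != 0 & S n P (linprod (nseq n t)) = k *: \prod_(a <- s) ('X - (a / t)%:P)].
Proof.
move=> t0 [s EP] P0 szP; exists s; split=> //.
exists (lead_coef P * t ^+ size s); first by rewrite mulf_neq0 ?expf_neq0 // lead_coef_eq0.
have -> : S n P (linprod (nseq n t)) = P \Po (t *: 'X).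
  apply/polyP => i; rewrite coef_S_nseq //.
  have -> : P \Po (t *: 'X) = \sum_(j < size P) (P`_j * t ^+ j) *: 'X^j.
    by rewrite comp_polyE; apply: eq_bigr => j _; rewrite exprZn scalerA.
  rewrite -(poly_def (size P) (fun j => P`_j * t ^+ j)) coef_poly; case: ltnP => // le_i.
  by rewrite (leq_sizeP _ _ (leqnn (size P))) // mul0r.
rewrite {1}EP comp_polyZ -scalerA; congr (_ *: _).
elim: s {EP} => [|a s IH]; first by rewrite !big_nil comp_polyC expr0 scale1r.
have lin : ('X - a%:P) \Po (t *: 'X) = t *: ('X - (a / t)%:P).
  rewrite comp_polyB comp_polyX comp_polyC scalerBr; congr (_ - _).
  by rewrite -mul_polyC -polyCM mulrC divfK.
by rewrite !big_cons comp_polyM IH lin /= exprS -scalerAl -scalerAr scalerA.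
Qed.

(** Induction on [ts], comparing the pair f, G with the pair P, P'. Both have the same
    multiplicities at 0 and the same values there, so the side counts change from G to f exactly as
    from P' to P. *)
Lemma nb_S0 ts P : splits P -> size P = (size ts).+1 -> {in ts, forall t, 0 < t} ->
  let f := S (size ts) P (linprod ts) in
  nb_left f 0 = nb_left P 0 /\ nb_right f 0 = nb_right P 0.
Proof.
elim: ts P => [|t ts IH] P sP szP pos f.
  have -> // : f = P.
  by rewrite /f -[[::]]/(nseq 0 1) S_ones // szP.
have [szP' P'0] := size_deriv_eq szP.
have pos' : {in ts, forall t, 0 < t} by move=> u us; apply: pos; rewrite inE us orbT.
have P0 : P != 0 by rewrite -size_poly_eq0 szP.
have [El Er] := IH _ (splits_deriv sP) szP' pos'.
have [fG sG szf szG lc] := S_interlaces sP szP pos.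
have [PP' lc'] := deriv_interlaces sP szP.
have [_ c1] := size_linprod_pos pos; have [_ c2] := size_linprod_pos pos'.
have [||f0 mf] := @mup0_S R (size ts).+1 P (linprod (t :: ts)) P0.
- by rewrite szP.
- by move=> i li; rewrite gt_eqF // c1.
have [||G0 mG] := @mup0_S R (size ts) P^`() (linprod ts) P'0.
- by rewrite szP'.
- by move=> i li; rewrite gt_eqF // c2.
have sP' := splits_deriv sP.
have szfG : size (S (size ts).+1 P (linprod (t :: ts))) =
    (size (S (size ts) P^`() (linprod ts))).+1 by rewrite szf szG.
have szPP' : size P = (size P^`()).+1 by rewrite szP szP'.
have [rP|rP] := boolP (root P 0).
  have E := mup_deriv P0 rP.
  have [-> ->] := interlaces_mupS PP' P0 P'0 szPP' sP' E.
  by rewrite -mf -mG in E; have [-> ->] := interlaces_mupS fG f0 G0 szfG sG E.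
have [rP'|rP'] := boolP (root P^`() 0).
  (* The root 0 of P' is simple, since a multiple one would be a root of [P]. *)
  have E : mup 0 P^`() = (mup 0 P).+1.
    have := rP'; rewrite -mup_gt0 // (mupNroot rP) => h; apply/eqP; rewrite eqn_leq h andbT.
    rewrite leqNgt; apply/negP => m1; have := mup_multiple_deriv sP P'0 m1.
    by rewrite (mupNroot rP).
  have [-> ->] := interlaces_Smup PP' P0 P'0 szPP' sP' E.
  rewrite -mf -mG in E; have [-> ->] := interlaces_Smup fG f0 G0 szfG sG E.
  by rewrite El Er.
have L0 us : (linprod us)`_0 = 1 :> R.
  elim: us => [|u us IHu]; first by rewrite /linprod big_nil coef1.
  by rewrite linprod_cons mulrDl mul1r coefD -scalerAl coefZ coefXM mulr0 addr0.
have hf : f.[0] = P.[0] by rewrite !horner_coef0 coef_S /= L0 mulr1 divr1.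
have hG : (S (size ts) P^`() (linprod ts)).[0] = P^`().[0].
  by rewrite !horner_coef0 coef_S /= L0 mulr1 bin0 divr1.
have e0 (q : {poly R}) : q = ('X - 0%:P) ^+ 0 * q by rewrite mul1r.
have := @interlaces_sign _ _ _ 0 _ _ 0 PP' szPP' sP' lc' rP rP' (e0 _) (e0 _).
have := @interlaces_sign _ _ _ 0 _ _ 0 fG szfG sG lc _ _ (e0 _) (e0 _).
rewrite !rootE -/f hf hG -!rootE rP rP' => /(_ isT isT).
by case: ifP => _ [-> ->] [-> ->]; rewrite El Er.
Qed.

Lemma linprod_perm ts us : perm_eq ts us -> linprod ts = linprod us :> {poly R}.
Proof. by move=> h; rewrite /linprod (perm_big _ h). Qed.

End Composition.

(** * Position of the A-roots of the composition *)

Section Position.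
Variable R : realType.
Implicit Types (f G P Q : {poly R}) (s r ts : seq R) (n : nat).
Local Notation S := (@schur_szego R).

(** With c = 1/(size ts + 1), f = c ((t X - al) G + (K + al G)), where K + al G is the composition
    with the polar derivative of P at al. The latter keeps the multiplicity of al, so K + al G
    vanishes at x to order at least mu + 1, whereas G has order mu. *)
Lemma S_cofactor t ts P (x al : R) mu : splits P -> size P = (size ts).+2 ->
  x != 0 -> al != 0 -> t * x != al ->
  (mup al P + count (fun t => (t * x)%R == al) ts = (size ts).+1 + mu)%N ->
  exists f2 G2, [/\
    S (size ts).+1 P (linprod (t :: ts)) = ('X - x%:P) ^+ mu * f2,
    S (size ts) P^`() (linprod ts) = ('X - x%:P) ^+ mu * G2,
    ~~ root f2 x, ~~ root G2 x &
    f2.[x] = (size ts).+1%:R^-1 * (t * x - al) * G2.[x]].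
Proof.
move=> sP szP x0 al0 tx Em; have [szP' P'0] := size_deriv_eq szP.
have P0 : P != 0 by rewrite -size_poly_eq0 szP.
have m0 : root P al.
  rewrite -mup_gt0 //.
  have aux (a b c d : nat) : (a + b = c.+1 + d -> b <= c -> 0 < a)%N by lia.
  exact: aux Em (count_size _ _).
have EP' := mup_deriv P0 m0.
have Em' : (mup al P^`() + count (fun t => (t * x)%R == al) ts = size ts + mu)%N.
  by move: Em; rewrite EP' !addSn => -[].
have [|G0 mG] := mup_S_linprod x0 al0 P'0 _ Em'; first by rewrite szP'.
have [G2 G2x EG] := mup_factor x G0; rewrite mG in EG.
set G := S _ _ _ in G0 mG EG; set K := S (size ts) (polar (size ts).+1 0 P) (linprod ts).
have [H EH] : exists H, K + al *: G = ('X - x%:P) ^+ mu.+1 * H.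
  have -> : K + al *: G = S (size ts) (polar (size ts).+1 al P) (linprod ts).
    by rewrite (polarE _ al) S_add S_scale.
  have [->|p0] := eqVneq (polar (size ts).+1 al P) 0; first by exists 0; rewrite S_0 mulr0.
  have szp : (size P <= (size ts).+2)%N by rewrite szP.
  have [||q0 mq] := @mup_S_linprod R ts (polar (size ts).+1 al P) x al mu.+1 x0 al0 p0.
  - exact: size_polar.
  - by rewrite (mup_polar_eq P0 szp p0) Em addSnnS.
  by have [H _ EH] := mup_factor x q0; exists H; rewrite {1}EH mq.
exists ((size ts).+1%:R^-1 *: ((t *: 'X - al%:P) * G2 + ('X - x%:P) * H)), G2.
have Ev : ((size ts).+1%:R^-1 *: ((t *: 'X - al%:P) * G2 + ('X - x%:P) * H)).[x] =
   (size ts).+1%:R^-1 * (t * x - al) * G2.[x].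
  by rewrite !(hornerZ, hornerD, hornerM, hornerX, hornerN, hornerC) subrr mul0r addr0 mulrA.
split=> //; last first.
  by rewrite rootE Ev -mulrA !mulf_neq0 ?invr_eq0 ?pnatr_eq0 // subr_eq0.
rewrite linprod_cons S_rec ?size_linprod // -/K -/G -scalerAr; congr (_ *: _).
have -> : K + t *: ('X * G) = (t *: 'X - al%:P) * G + (K + al *: G).
  by rewrite -!mul_polyC; ring.
by rewrite EH {1}EG exprS; ring.
Qed.

(** If every t equals t0 = al/x, the composition is P(t0 X) up to a constant. Otherwise some t <> t0
    is removed: f and G have the same multiplicity at x, and by [S_cofactor] the sign of t x - al
    decides on which side the additional root lies, while P and P' have equally many roots to the
    left of al. *)
Lemma nb_left_A ts P (x al : R) mu : splits P -> size P = (size ts).+1 ->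
  {in ts, forall t, 0 < t} -> x != 0 -> al != 0 -> 0 < al / x ->
  (mup al P + count (fun t => (t * x)%R == al) ts = size ts + mu)%N ->
  nb_left (S (size ts) P (linprod ts)) x =
  (nb_left P al + if (0 < al)%R then count (fun t => al / x < t)%R ts
                  else count (fun t => t < al / x)%R ts)%N.
Proof.
move=> + + + x0 al0 t0_gt0; set t0 := al / x.
have Et (t : R) : (t * x == al) = (t == t0).
  by rewrite -[RHS](inj_eq (mulIf x0)) divfK.
elim: {ts}(size ts) {-2}ts (erefl (size ts)) P => [|n IH] ts szs P sP szP pos Em.
all: have P0 : P != 0 by rewrite -size_poly_eq0 szP.
all: have [allt|/allPn[t tts tt0]] := boolP (all (fun t => t == t0) ts).
2: by rewrite (size0nil szs) in tts.
1,2: have Ets : ts = nseq (size ts) t0 by apply/all_pred1P.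
1,2: have [||s [EP [k k0 ES]]] := @S_scaling R (size ts) t0 P _ sP P0;
       rewrite ?szP //; first by rewrite gt_eqF.
1,2: rewrite {2}Ets ES -(big_map (fun a => a / t0) xpredT (fun a => 'X - a%:P)) nb_leftE //.
1,2: rewrite EP nb_leftE ?lead_coef_eq0 // Ets !count_nseq !ltxx !mul0n if_same addn0 count_map.
1,2: by apply: eq_count => a /=; rewrite ltr_pdivrMr // mulrC divfK.
have pe := perm_to_rem tts; set us := rem t ts in pe.
have szu : size us = n by rewrite size_rem // szs.
have {}tx : t * x != al by rewrite Et.
have posu : {in t :: us, forall t, 0 < t} by move=> u; rewrite -(perm_mem pe); exact: pos.
have posu' : {in us, forall t, 0 < t} by move=> u uu; apply: posu; rewrite inE uu orbT.
have szP2 : size P = (size us).+2 by rewrite szP szs szu.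
have Em2 : (mup al P + count (fun t => (t * x)%R == al) us = (size us).+1 + mu)%N.
  by rewrite szu -szs -Em (permP pe) /= (negPf tx).
rewrite (linprod_perm pe) (perm_size pe) !(permP pe) /=.
have [szP' P'0] := size_deriv_eq szP2.
have rP : root P al.
  rewrite -mup_gt0 //.
  have aux (a b c d : nat) : (a + b = c.+1 + d -> b <= c -> 0 < a)%N by lia.
  exact: aux Em2 (count_size _ _).
have EP' := mup_deriv P0 rP.
have {}IH := IH us szu _ (splits_deriv sP) szP' posu'.
have Em' : (mup al P^`() + count (fun t => (t * x)%R == al) us = size us + mu)%N.
  by move: Em2; rewrite EP' !addSn => -[].
have {Em'}IH := IH Em'.
have [PP' lc'] := deriv_interlaces sP szP2.
have szPP' : size P = (size P^`()).+1 by rewrite szP2 szP'.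
have [EL _] := interlaces_mupS PP' P0 P'0 szPP' (splits_deriv sP) EP'.
have [fG sG szf szG lc] := S_interlaces sP szP2 posu.
have [f2 [G2 [Ef EG rf rG E2]]] := S_cofactor sP szP2 x0 al0 tx Em2.
have := interlaces_sign fG _ sG lc rf rG Ef EG; rewrite szf szG => /(_ erefl).
have -> : (0 < f2.[x] * G2.[x]) = if 0 < al then t0 < t else t < t0.
  have -> : f2.[x] * G2.[x] = (size us).+1%:R^-1 * (t * x - al) * G2.[x] ^+ 2.
    by rewrite E2; ring.
  rewrite pmulr_lgt0 ?exprn_even_gt0 //= pmulr_rgt0 ?invr_gt0 ?ltr0n //.
  have Eal : al = t0 * x by rewrite divfK.
  rewrite {1 2}Eal -mulrBl; case: ifP => h.
    by rewrite pmulr_lgt0 ?subr_gt0 //; move: h; rewrite pmulr_rgt0.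
  rewrite nmulr_lgt0 ?subr_lt0 //; move: h; rewrite pmulr_rgt0 // => /negbT.
  by rewrite -leNgt lt_neqAle x0.
rewrite EL; case: (0 < al) IH => IH; case: ifP => _ [-> _]; by rewrite IH /= ?add1n ?add0n ?addnS.
Qed.

End Position.

(** * The conditions (o), (i), (ii) for the composition *)

Section Conditions.
Variable R : realType.
Implicit Types (f G P Q : {poly R}) (s r ts : seq R) (n : nat).
Local Notation S := (@schur_szego R).

Lemma Hyp_splits n P : Hyp n P <-> splits P /\ size P = n.+1.
Proof.
split=> [[szP rP]|[sP szP]]; first by split=> //; apply: splits_complex.
by split=> // z; apply: splits_root => //; rewrite -size_poly_eq0 szP.
Qed.

Lemma splits_mupD P (x y : R) n : splits P -> size P = n.+1 -> x != y ->
  (mup x P + mup y P <= n)%N.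
Proof.
move=> [s EP] szP xy; have k0 : lead_coef P != 0.
  by rewrite lead_coef_eq0 -size_poly_eq0 szP.
move: szP; rewrite EP size_scale // size_prod_XsubC => -[<-].
rewrite !mupZ // !mu_prod_XsubC; elim: s {EP} => //= z s IH.
case: (eqVneq z x) => [->|_]; first by rewrite (negPf xy); lia.
by case: eqP => _; lia.
Qed.

(** Otherwise the partners of x and y would give two distinct roots of P and two of Q of total
    multiplicity above 2n. *)
Lemma A_pair_trans n P Q (x y : R) : splits P -> splits Q -> size P = n.+1 -> size Q = n.+1 ->
  A_root_l n P Q x -> A_root_r n P Q y -> A_pair n P Q x y.
Proof.
move=> sP sQ szP szQ [y' [rx ry' m1]] [x' [rx' ry m2]]; split=> //.
have [->|xx'] := eqVneq x x'; first by [].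
have [<-|yy'] := eqVneq y' y; first by [].
have := splits_mupD sP szP xx'; have := splits_mupD sQ szQ yy'; lia.
Qed.

Lemma Hyp_neg_linprod n Q : Hyp_neg n Q -> exists q s, let ts := [seq - y^-1 | y <- s] in
  [/\ q != 0, Q = q *: linprod ts, Q = lead_coef Q *: \prod_(y <- s) ('X - y%:P),
      {in s, forall y, y < 0} & size s = n].
Proof.
move=> [/Hyp_splits[[s EQ] szQ] negQ]; have k0 : lead_coef Q != 0.
  by rewrite lead_coef_eq0 -size_poly_eq0 szQ.
have neg : {in s, forall y, y < 0}.
  by move=> y ys; apply: negQ; rewrite EQ rootZ // root_prod_XsubC.
exists (lead_coef Q * \prod_(y <- s) (- y)), s; split=> //.
- rewrite mulf_neq0 // prodf_seq_neq0; apply/allP => y /neg y0 /=.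
  by rewrite oppr_eq0 lt_eqF.
- rewrite {1}EQ -scalerA; congr (_ *: _); rewrite /linprod big_map.
  elim: s neg {EQ} => [|y s IH] neg; first by rewrite !big_nil scale1r.
  rewrite !big_cons IH => [|z zs]; last by apply: neg; rewrite inE zs orbT.
  have y0 : y != 0 by rewrite lt_eqF // neg ?mem_head.
  by rewrite XsubC_scale // -scalerAl -scalerAr scalerA.
move: szQ; rewrite EQ size_scale // size_prod_XsubC => -[].
by [].
Qed.

Lemma S_scale_r n k P Q : S n P (k *: Q) = k *: S n P Q.
Proof. by rewrite S_C S_scale S_C. Qed.

Lemma nb_scale k f c : k != 0 -> splits f -> f != 0 ->
  nb_left (k *: f) c = nb_left f c /\ nb_right (k *: f) c = nb_right f c.
Proof.
move=> k0 [s Ef]; rewrite -lead_coef_eq0 => l0.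
by rewrite Ef scalerA !nb_leftE ?nb_rightE ?mulf_neq0.
Qed.

Lemma composition_conditions n u v w P Q : Huvw n u v w P -> Hyp_neg n Q ->
  [/\ cond_o n u v w P Q (S n P Q), cond_i n P Q (S n P Q) & cond_ii n P Q (S n P Q)].
Proof.
move=> [/Hyp_splits[sP szP] Eu Ev Ew] hQ.
have [/Hyp_splits[sQ szQ] negQ] := hQ.
have P0 : P != 0 by rewrite -size_poly_eq0 szP.
have Q0 : Q != 0 by rewrite -size_poly_eq0 szQ.
have [q [s [q0 EQ EQs neg szs]]] := Hyp_neg_linprod hQ.
have kQ0 : lead_coef Q != 0 by rewrite lead_coef_eq0.
set ts := map _ s in EQ.
have szts : size ts = n by rewrite size_map.
have pos : {in ts, forall t, 0 < t}.
  by move=> t /mapP[y /neg y0 ->]; rewrite oppr_gt0 invr_lt0.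
have szP' : size P = (size ts).+1 by rewrite szts.
have [szF lcF] := lead_S szP szQ.
have F0 : S n P Q != 0 by rewrite -size_poly_eq0 szF.
have EF : S n P Q = q *: S (size ts) P (linprod ts) by rewrite szts -S_scale_r -EQ.
have f0 : S (size ts) P (linprod ts) != 0.
  by apply: contraNneq F0 => E; rewrite EF E scaler0.
have sf := splits_S sP szP' pos.
have nbF c : nb_left (S n P Q) c = nb_left (S (size ts) P (linprod ts)) c /\
  nb_right (S n P Q) c = nb_right (S (size ts) P (linprod ts)) c.
  by rewrite EF; exact: nb_scale.
have mup0F : mup 0 (S n P Q) = mup 0 P.
  rewrite EF mupZ //; apply: (mup0_S P0 _ _).2; first by rewrite szP'.
  by move=> i li; rewrite gt_eqF // (size_linprod_pos pos).2.
(* For t = - 1/y, the equation t (- a b) = a means y = b. *)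
have cnt a b : a != 0 -> b < 0 ->
   count (fun t => (t * - (a * b))%R == a) ts = mup b Q.
  move=> a0 b0; rewrite {1}EQs mupZ // mu_prod_XsubC count_map; apply: eq_in_count => y /neg y0 /=.
  have y0' : y != 0 by rewrite lt_eqF.
  rewrite mulrNN mulrCA -[RHS]eq_sym -[LHS](inj_eq (mulfI (invr_neq0 a0))) mulKf // mulVf //.
  by rewrite -[LHS](inj_eq (mulfI y0')) mulVKf // mulr1.
have splitsF : splits (S n P Q).
  case: sf => s' Ef; rewrite EF Ef scalerA; exact: splits_prod.
split.
- split.
    split; last 1 first.
    + by rewrite (nbF 0).2 (nb_S0 sP szP' pos).2.
    + exact/Hyp_splits.
    + by rewrite (nbF 0).1 (nb_S0 sP szP' pos).1.
    + by rewrite mup0F.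
  move=> a b a0 ra rb lt_n; have b0 : b != 0 by rewrite lt_eqF // negQ.
  have [||_ Em] := mup_S a0 b0 P0 Q0 _ _ (esym (subnKC (ltnW lt_n))).
  + by rewrite szP.
  + by rewrite szQ.
  by rewrite -mup_gt0 // Em subn_gt0.
- move=> a b a0 Aa Ab; have [ra rb lt_n] := A_pair_trans sP sQ szP szQ Aa Ab.
  have b0 : b < 0 by apply: negQ.
  have x0 : - (a * b) != 0 by rewrite oppr_eq0 mulf_neq0 // lt_eqF.
  have Et0 : a / - (a * b) = - b^-1 by field; rewrite a0 lt_eqF.
  rewrite (nbF _).1.
  rewrite (@nb_left_A R ts P (- (a * b)) a (mup a P + mup b Q - n) sP szP' pos x0 a0); last 2 first.
  + by rewrite Et0 oppr_gt0 invr_lt0.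
  + by rewrite cnt // szts subnKC // ltnW.
  rewrite Et0 /nb_sign EQs nb_leftE // nb_rightE //; congr (_ + _)%N.
  (* The map y -> - 1/y is increasing on the negative numbers, so it preserves the sides. *)
  have eqc y : y < 0 -> ((- b^-1 < - y^-1) = (b < y)) * ((- y^-1 < - b^-1) = (y < b)).
    by move=> y0; rewrite !ltrN2 !ltf_nV2 ?negrE.
  by case: ifP => _; rewrite count_map; apply: eq_in_count => y /neg /eqc /= ->.
(* A multiple root is shown to be an A-root: 0 by convention, since it is then a root of [P], and
   any other one by [mup_multiple_S]. *)
move=> z rz nA; apply/eqP; rewrite eqn_leq mup_gt0 // rz andbT leqNgt; apply/negP => m1.
apply: nA; have [z0|z0] := eqVneq z 0.
  by right; split=> //; rewrite -mup_gt0 // -mup0F mup_gt0 // -z0.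
move: m1; rewrite EF mupZ // => m1.
have [|al al0 Em] := mup_multiple_S sP P0 _ pos z0 m1; first by rewrite szP'.
(* The partner is forced by z = - al be. *)
left; exists al, (- (z / al)).
have Ez : z = - (al * - (z / al)) by field.
have ral : root P al.
  rewrite -mup_gt0 //; have aux (a b c d : nat) : (a + b = c + d -> b <= c -> 1 < d -> 0 < a)%N by lia.
  exact: aux Em (count_size _ _) m1.
have cpos : (0 < count (fun t => (t * z)%R == al) ts)%N.
  have aux (a b c d : nat) : (a + b = c + d -> a <= c -> 1 < d -> 0 < b)%N by lia.
  by apply: aux Em _ m1; apply: mup_size => //; rewrite szP'.
have b0 : - (z / al) < 0.
  move: cpos; rewrite -has_count => /hasP[t /pos t0 /eqP <-].
  by rewrite invfM mulrCA mulfV // mulr1 oppr_lt0 invr_gt0.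
have Emb : mup (- (z / al)) Q = count (fun t => (t * z)%R == al) ts.
  by rewrite -(cnt al) // -Ez.
split=> //; split=> //; first by rewrite -mup_gt0 // Emb.
by rewrite Emb Em -[X in (X < _)%N]szts -[X in (X < _)%N]addn0 ltn_add2l ltnW.
Qed.

End Conditions.

(** * Multiplicity vectors *)

Section Partitions.
Implicit Types (c : seq nat) (n k : nat).

Lemma before_cons a c k : before (a :: c) k.+1 = (a + before c k)%N.
Proof. by []. Qed.

Lemma before_inj c k1 k2 : 0%N \notin c -> (k1 < size c)%N -> (k2 < size c)%N ->
  before c k1 = before c k2 -> k1 = k2.
Proof.
elim: c k1 k2 => [|a c IH] [|k1] [|k2] //=; rewrite inE negb_or eq_sym -lt0n => /andP[a0 c0].
- by move=> _ _; rewrite before_cons /before take0 /=; lia.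
- by move=> _ _; rewrite before_cons /before take0 /=; lia.
by rewrite !ltnS => h1 h2; rewrite !before_cons => /addnI /(IH _ _ c0 h1 h2) ->.
Qed.

(** The first parts both start at 0, hence agree; once they are removed, the hypothesis passes to
    the remaining parts. *)
Lemma eq_partition c c' : 0%N \notin c -> 0%N \notin c' -> sumn c = sumn c' ->
  (forall k k', (k < size c)%N -> (k' < size c')%N -> before c k = before c' k' ->
     nth 0%N c k = nth 0%N c' k') -> c = c'.
Proof.
elim: c c' => [|a c IH] [|a' c'] //=; rewrite ?inE ?negb_or.
- by move=> _ /andP[a0 _] /esym/eqP; rewrite addn_eq0 eq_sym (negPf a0).
- by move=> /andP[a0 _] _ /eqP; rewrite addn_eq0 eq_sym (negPf a0).
move=> /andP[_ c0] /andP[_ c0'] + H; have /= Ea := H 0%N 0%N isT isT erefl.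
rewrite Ea => /addnI Es; rewrite (IH c') // => k k' hk hk' Eb.
by have := H k.+1 k'.+1 hk hk'; rewrite !before_cons Ea Eb => /(_ erefl).
Qed.

Lemma compatible_zero_part n u v w mP mQ c k : 0%N \notin c ->
  compatible n u v w mP mQ c -> (0 < v)%N -> (k < size c)%N -> before c k = u ->
  nth 0%N c k = v.
Proof.
move=> c0 [[cneg [cpos [Ec En _]]] _ _] v0 lt_k Ek.
have lt_n : (size cneg < size c)%N by rewrite Ec !size_cat v0 /=; lia.
have -> : k = size cneg.
  by apply: (before_inj c0) => //; rewrite Ek Ec /before take_size_cat.
by rewrite Ec nth_cat ltnn subnn v0.
Qed.

(** In a compatible partition the position of a part determines its size: v for the part of the root
    0, the excess at a position prescribed by (i), and 1 elsewhere. *)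
Lemma compatible_unique n u v w mP mQ c c' :
  ordered_partition n c -> compatible n u v w mP mQ c ->
  ordered_partition n c' -> compatible n u v w mP mQ c' -> c = c'.
Proof.
move=> [Es c0] Hc [Es' c0'] Hc'; apply: eq_partition => //; first by rewrite Es.
move=> k k' lk lk' Eb.
have [v0|v0] := boolP ((0 < v)%N && (before c k == u)).
  case/andP: v0 => v0 /eqP Ek.
  by rewrite (compatible_zero_part c0 Hc v0 lk Ek) (compatible_zero_part c0' Hc' v0 lk') // -Eb.
have nz : ~ ((0 < v)%N /\ before c k = u).
  by move=> [h1 h2]; move: v0; rewrite h1 h2 eqxx.
have [_ A B] := Hc; have [_ A' B'] := Hc'.
have [[i [j [Hij Ek]]]|nA] :=
  boolp.pselect (exists i j, A_index n u v mP mQ i j /\ before c k = A_position u mP mQ i j).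
  have [l [ll El E1]] := A i j Hij; have [l' [ll' El' E2]] := A' i j Hij.
  have <- : l = k by apply: before_inj c0 ll lk _; rewrite El Ek.
  have <- : l' = k' by apply: before_inj c0' ll' lk' _; rewrite El' -Eb Ek.
  by rewrite E1 E2.
by rewrite B // B' // -Eb.
Qed.

End Partitions.

(** * From the roots of a polynomial to the parts of its multiplicity vector *)

Section MultiplicityVector.
Variable R : realType.
Implicit Types (P Q : {poly R}) (n : nat).

Lemma sorted_filter3 (s : seq R) c : sorted <%R s ->
  s = [seq x <- s | x < c] ++ [seq x <- s | x == c] ++ [seq x <- s | c < x].
Proof.
elim: s => //= x s IH ps; have {IH}Es := IH (path_sorted ps).
have xs : {in s, forall y, x < y} by apply/allP; rewrite (order_path_min lt_trans ps).
have none (p : pred R) : {in s, forall y, ~~ p y} -> filter p s = [::].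
  by move=> h; apply/eqP; rewrite -[_ == _]negbK -has_filter; apply/hasPn.
case: (ltgtP x c) => [xc|cx|Exc] /=; first by rewrite {1}Es.
- have e1 : [seq y <- s | y < c] = [::].
    by apply: none => y /xs xy; rewrite -leNgt ltW // (lt_trans cx).
  have e2 : [seq y <- s | y == c] = [::].
    by apply: none => y /xs xy; rewrite gt_eqF // (lt_trans cx).
  by rewrite e1 e2 /= {1}Es e1 e2.
have e1 : [seq y <- s | y < c] = [::].
  by apply: none => y /xs xy; rewrite -leNgt -Exc ltW.
have e2 : [seq y <- s | y == c] = [::].
  by apply: none => y /xs xy; rewrite gt_eqF // -Exc.
by rewrite e1 e2 /= {1}Es e1 e2.
Qed.

Lemma size_MV P : size (MV P) = size (rootsR P).
Proof. by rewrite size_map. Qed.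

Lemma MV_nth P k : (k < size (rootsR P))%N ->
  let z := (rootsR P)`_k in
  [/\ nth 0%N (MV P) k = mup z P, before (MV P) k = nb_left P z & after (MV P) k = nb_right P z].
Proof.
move=> lk z; have ss : sorted <%R (rootsR P) by exact: sorted_roots.
split; first by rewrite (nth_map 0).
  rewrite /before /MV -map_take sumnE big_map -(filter_lt_nth 0 ss lk) big_filter.
  by [].
rewrite /after /MV -map_drop sumnE big_map /nb_right -[RHS]big_filter; congr (\sum_(x <- _) _)%N.
rewrite -[in RHS](cat_take_drop k.+1 (rootsR P)) filter_cat.
rewrite -(filter_le_nth 0 ss lk) -filter_predI (eq_filter (a2 := pred0)); last first.
  by move=> x /=; rewrite -/z leNgt; case: (_ < _).
rewrite filter_pred0 cat0s; apply/esym/all_filterP/(all_nthP 0) => i.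
rewrite size_drop nth_drop => li; rewrite lt_sorted_ltn_nth // ?inE //.
  by rewrite addSn ltnS leq_addr.
by rewrite -ltn_subRL.
Qed.

Lemma MV_root P z : P != 0 -> root P z -> exists k,
  [/\ (k < size (MV P))%N, (rootsR P)`_k = z, nth 0%N (MV P) k = mup z P,
      before (MV P) k = nb_left P z & after (MV P) k = nb_right P z].
Proof.
move=> P0 rz; have zr : z \in rootsR P by rewrite mem_rootsR.
have lk : (index z (rootsR P) < size (rootsR P))%N by rewrite index_mem.
exists (index z (rootsR P)); rewrite size_MV.
by have [] := MV_nth lk; rewrite nth_index.
Qed.

Lemma MV_partition n P : Hyp n P -> ordered_partition n (MV P).
Proof.
move=> /Hyp_splits[sP szP]; have P0 : P != 0 by rewrite -size_poly_eq0 szP.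
split; last first.
  apply/mapP => -[x]; rewrite mem_rootsR // -mup_gt0 // => + E.
  by rewrite -E.
case: sP => s EP; have k0 : lead_coef P != 0 by rewrite lead_coef_eq0.
rewrite sumnE big_map [in LHS]EP (sum_mup_rootsR s predT k0) count_predT.
by move: szP; rewrite EP size_scale // size_prod_XsubC => -[].
Qed.

Lemma nb_left_mono P (x y : R) : splits P -> P != 0 -> x < y ->
  (nb_left P x + mup x P <= nb_left P y)%N.
Proof.
move=> [s EP]; rewrite -lead_coef_eq0 => k0 xy.
rewrite EP !nb_leftE // mupZ // mu_prod_XsubC.
elim: s {EP} => //= z s IH.
have : ((z < x)%R + (z == x) <= (z < y)%R)%N.
  by case: (ltgtP z x) => [zx|_|->] //=; rewrite ?(lt_trans zx xy) ?xy.
by move=> h; rewrite addnACA leq_add.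
Qed.

(** The k-th root has [before _ k] roots to its left, which translates each condition on roots into
    the clause on indices. *)
Lemma conditions_compatible n u v w P Q F : Huvw n u v w P -> Hyp_neg n Q ->
  cond_o n u v w P Q F -> cond_i n P Q F -> cond_ii n P Q F ->
  ordered_partition n (MV F) /\ compatible n u v w (MV P) (MV Q) (MV F).
Proof.
move=> [/Hyp_splits[sP szP] Eu Ev Ew] [/Hyp_splits[sQ szQ] negQ].
move=> [[hF Fu Fv Fw] Fo] Fi Fii; split; first exact: MV_partition.
have [sF szF] := (Hyp_splits n F).1 hF.
have P0 : P != 0 by rewrite -size_poly_eq0 szP.
have Q0 : Q != 0 by rewrite -size_poly_eq0 szQ.
have F0 : F != 0 by rewrite -size_poly_eq0 szF.
(* As [P] has u negative roots and 0 has multiplicity v, the number of roots to the left of x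
   reveals the sign of x. *)
have nzP x : x != 0 -> root P x -> ~~ (u <= nb_left P x < u + v)%N /\
   ((nb_left P x < u)%N = (x < 0)).
  rewrite -Eu -Ev -mup_gt0 // => x0 mx; case: (ltgtP x 0) x0 => // [x_lt0|x_gt0] _.
    have aux (k l m d : nat) : (0 < m -> k + m <= l ->
      ~~ (l <= k < l + d) /\ (k < l = true))%N by lia.
    exact: aux mx (nb_left_mono sP P0 x_lt0).
  have aux (k l d : nat) : (l + d <= k -> ~~ (l <= k < l + d) /\ (k < l = false))%N by lia.
  exact: aux (nb_left_mono sP P0 x_gt0).
have posE x y i j : x != 0 -> root P x -> before (MV P) i = nb_left P x ->
   before (MV Q) j = nb_left Q y -> after (MV Q) j = nb_right Q y ->
   A_position u (MV P) (MV Q) i j = (nb_left P x + nb_sign x Q y)%N.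
  move=> x0 rx Ei Ej1 Ej2; rewrite /A_position Ei (nzP _ x0 rx).2 Ej1 Ej2 /nb_sign.
  by case: (ltgtP x 0) x0.
split.
- have ss : sorted <%R (rootsR F) by exact: sorted_roots.
  pose m x := mup x F.
  exists [seq m x | x <- rootsR F & x < 0], [seq m x | x <- rootsR F & 0 < x]; split.
  + rewrite /MV {1}(sorted_filter3 0 ss) !map_cat; congr (_ ++ (_ ++ _)).
    have [r0|r0] := boolP (root F 0).
      rewrite filter_pred1_uniq ?uniq_rootsR ?mem_rootsR //= Fv.
      by rewrite -Fv mup_gt0 // r0.
    rewrite -Fv (mupNroot r0) /= (_ : filter _ _ = [::]) //.
    by apply/eqP; rewrite -[_ == _]negbK -has_filter has_pred1 mem_rootsR.
  + by rewrite sumnE big_map big_filter.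
  + by rewrite sumnE big_map big_filter.
- move=> i j [li lj nz lt_n].
  have li' : (i < size (rootsR P))%N by rewrite -size_MV.
  have lj' : (j < size (rootsR Q))%N by rewrite -size_MV.
  have [Ei1 Ei2 Ei3] := MV_nth li'; have [Ej1 Ej2 Ej3] := MV_nth lj'.
  set a := (rootsR P)`_i in Ei1 Ei2 Ei3; set b := (rootsR Q)`_j in Ej1 Ej2 Ej3.
  have ra : root P a by rewrite -mem_rootsR // mem_nth.
  have rb : root Q b by rewrite -mem_rootsR // mem_nth.
  have a0 : a != 0.
    apply: contraNneq nz => E; rewrite Ei2 E Eu leqnn /= -[X in (X < _)%N]addn0 ltn_add2l.
    by rewrite -Ev mup_gt0 // -E.
  rewrite Ei1 Ej1 in lt_n *; have [rF mF] := Fo a b a0 ra rb lt_n.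
  have [k [lk Ek Ek1 Ek2 Ek3]] := MV_root F0 rF.
  exists k; split=> //; last by rewrite Ek1 mF.
  by rewrite Ek2 (posE a b) // Fi //; [exists b | exists a].
move=> k lk nA nz; have lk' : (k < size (rootsR F))%N by rewrite -size_MV.
have [Ek1 Ek2 _] := MV_nth lk'; set z := (rootsR F)`_k in Ek1 Ek2.
have rz : root F z by rewrite -mem_rootsR // mem_nth.
(* If P(0) = 0, the root 0 of [F] sits at position u, which is excluded here; this also disposes of
   the pairs with x = 0, which [A_index] does not cover. *)
rewrite Ek1; have z_not0 : root P 0 -> z = 0 -> False.
  move=> rP z0; apply: nz; rewrite Ek2 z0 Fu; split=> //.
  by rewrite -Ev mup_gt0.
apply: Fii => // -[[x [y [[rx ry lt_n] Ez]]]|[rP z0]]; last exact: z_not0 rP z0.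
have [x0|x0] := eqVneq x 0.
  by apply: z_not0; [rewrite -x0 | rewrite Ez x0 mul0r oppr0].
apply: nA; have [i [li _ Ei1 Ei2 _]] := MV_root P0 rx; have [j [lj _ Ej1 Ej2 Ej3]] := MV_root Q0 ry.
exists i, j; split; last first.
  rewrite (posE x y) // Ek2 Ez Fi //; first by exists y.
  by exists x.
by split; rewrite ?Ei1 ?Ej1 // Ei2; have [] := nzP x x0 rx.
Qed.

End MultiplicityVector.

Theorem theorem6 (R : realType) (n : nat) (n_ge1 : (1 <= n)%N)
    (P Q : {poly R}) (u v w : nat)
    (hP : Hyp n P) (hQ : Hyp_neg n Q) (huvw : (u + v + w = n)%N)
    (hPuvw : Huvw n u v w P) :
  [/\ cond_o n u v w P Q (schur_szego n P Q),
      cond_i n P Q (schur_szego n P Q)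
    & cond_ii n P Q (schur_szego n P Q)] /\
  [/\ (* a polynomial satisfying the three conditions has this MV *)
      forall S : {poly R},
        cond_o n u v w P Q S -> cond_i n P Q S -> cond_ii n P Q S ->
        MV S = MV (schur_szego n P Q),
      (* MV depends only on MV_P, MV_Q and (u, v, w) *)
      forall P' Q' : {poly R},
        Huvw n u v w P' -> Hyp_neg n Q' -> MV P' = MV P -> MV Q' = MV Q ->
        MV (schur_szego n P' Q') = MV (schur_szego n P Q)
    & (* it is the unique ordered partition of n compatible with them *)
      forall c : seq nat,
        (ordered_partition n c /\ compatible n u v w (MV P) (MV Q) c) <->
        c = MV (schur_szego n P Q)].
Proof.
have conds := composition_conditions hPuvw hQ; split=> //.
have [co ci cii] := conds.
have [part comp] := conditions_compatible hPuvw hQ co ci cii.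
split.
- move=> S So Si Sii.
  have [pS cS] := conditions_compatible hPuvw hQ So Si Sii.
  exact: compatible_unique pS cS part comp.
- move=> P' Q' hP' hQ' EP EQ; have [co' ci' cii'] := composition_conditions hP' hQ'.
  have [pS cS] := conditions_compatible hP' hQ' co' ci' cii'.
  by rewrite EP EQ in cS; exact: compatible_unique pS cS part comp.
move=> c; split=> [[pc cc]|->]; last by [].
exact: compatible_unique pc cc part comp.
Qed.
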